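(* Suppose that $n-m_0+\ell_0=0$, and let $K_0$ be a perfect subfield of $K$. Then the following statements hold. (i) $m_0$ is $(n,d)$-reachable over $K_0$ if and only if $\mathrm{char}(K_0)$ does not divide $\ell_0$. (ii) Suppose that $\mathrm{char}(K_0)$ does not divide $\ell_0$, and consider the polynomial $f_0(x)=-x^{m_0}+(x^{\ell_0}+1)^d\in K_0[x]$. Then $f_0(x)$ is a degree $n$ polynomial without repeated roots and $\mathcal Q_0=(0,1)$ is a $K_0$-point of order $m_0$ on $\mathcal C_{f_0,d}$. (iii) Suppose that $\mathrm{char}(K_0)$ does not divide $\ell_0$, let $f_0$ and $\mathcal Q_0$ be the polynomial $f_0(x)=-x^{m_0}+(x^{\ell_0}+1)^d$ and the point $\mathcal Q_0=(0,1)\in\mathcal C_{f_0,d}(K_0)$, and let $f(x)\in K_0[x]$ be a degree $n$ polynomial without repeated roots such that $\mathcal C_{f,d}$ has a $K_0$-point $\mathcal P$ of order $m_0$. Then there is an isomorphism of the curves $\mathcal C_{f,d}$ and $\mathcal C_{f_0,d}$ over $K$ under which $\mathcal O_{f,d}$ goes to $\mathcal O_{f_0,d}$ and $\mathcal P$ goes to $\mathcal Q_0$.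
   Context: $K$ is an algebraically closed field; $n,d$ are integers with $2\le d<n$, $\gcd(n,d)=1$, $\mathrm{char}(K)\nmid d$. Put $\ell_0:=[(n+d)/d]$ (integer part) and $m_0:=d\ell_0$. For a degree $n$ polynomial $f(x)\in K[x]$ without repeated roots, $\mathcal C_{f,d}$ is the smooth projective model of the smooth plane affine curve $y^d=f(x)$, and $\mathcal O_{f,d}$ is its unique point at infinity. If $f(x)\in K_0[x]$ for a perfect subfield $K_0\subset K$, then $\mathcal C_{f,d}$ is viewed as a curve over $K_0$, and $\mathcal O_{f,d}$ is a $K_0$-point. The curve $\mathcal C_{f,d}$ is identified with its image in its Jacobian $J(\mathcal C_{f,d})$ under the embedding sending $\mathcal O_{f,d}$ to $0$; a point of $\mathcal C_{f,d}$ has order $m$ if its image in $J(\mathcal C_{f,d})$ has order $m$. An integer $m>1$ is called $(n,d)$-reachable over $K_0$ if there exists a degree $n$ polynomial $f(x)\in K_0[x]$ without repeated roots such that $\mathcal C_{f,d}(K_0)$ contains a torsion point of order $m$. *)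

(* Defs.v *)
From HB Require Import structures.
From mathcomp Require Import all_boot all_order all_algebra.
From mathcomp Require Import boolp.
Set Implicit Arguments.
Unset Strict Implicit.
Unset Printing Implicit Defensive.
Import Order.TTheory GRing.Theory Num.Theory.
Local Open Scope ring_scope.

(* With [char R] = 0 this says m <> 0, in agreement with "0 does not divide m". *)
Definition char_ndvd (R : nzRingType) (m : nat) : Prop := [pchar R]^'.-nat m.

(* A subfield K0 of K has the same characteristic as K, so that [pchar K] is
   used both for K and for K0. *)
Definition perfect_subfield (K : fieldType) (K0 : divringClosed K) : Prop :=
  forall p : nat, p \in [pchar K] ->
  forall a : K, a \in K0 -> exists2 b : K, b \in K0 & b ^+ p = a.

Definition no_repeated_roots (K : fieldType) (f : {poly K}) : Prop :=
  forall a : K, (mup a f <= 1)%N.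

Definition ell0 (n d : nat) : nat := ((n + d) %/ d)%N.
Definition m0 (n d : nat) : nat := (d * ell0 n d)%N.

Section Curve.
Variables (K : closedFieldType) (d : nat) (f : {poly K}).

(* The function field K(C_{f,d}) = K(x)[y] / (y^d - f(x)).  The polynomial
   Y^d - f(x) is irreducible over K(x) when the degree of f is prime to d, so
   that this ring is a field in all the cases of interest. *)
Definition curve_eqn : {poly {fraction {poly K}}} :=
  'X^d - (FracField.tofrac f)%:P.

Definition funfield := {poly %/ curve_eqn}.

Definition fratio (r : {fraction {poly K}}) : funfield :=
  in_qpoly curve_eqn r%:P.
Definition fconst (c : K) : funfield := fratio (FracField.tofrac c%:P).
Definition fx : funfield := fratio (FracField.tofrac 'X).
Definition fy : funfield := in_qpoly curve_eqn 'X.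

(* The smooth projective model C_{f,d} is the abstract nonsingular curve
   attached to K(C_{f,d}): its closed points are the discrete valuations of
   K(C_{f,d}) that are trivial on K and normalized (onto Z), the valuation
   attached to a point P being the order of vanishing ord_P.  The value at 0,
   which should be +oo, is set to 0, so that points are equal as soon as their
   valuations agree; the other axioms are only about nonzero functions. *)
Record point := Point {
  ord :> funfield -> int;
  ord_zero : ord 0 = 0;
  ord_mul : forall g h, g != 0 -> h != 0 -> ord (g * h) = ord g + ord h;
  ord_add : forall g h, g != 0 -> h != 0 -> g + h != 0 ->
           Num.min (ord g) (ord h) <= ord (g + h);
  ord_const : forall c : K, ord (fconst c) = 0;
  ord_onto : exists t, ord t = 1
}.

Definition at_infinity (P : point) : Prop := P fx < 0.

(* P is the point (a, b) of the affine curve y^d = f(x), that is, x - a and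
   y - b vanish at P. *)
Definition at_affine (P : point) (a b : K) : Prop :=
  [/\ b ^+ d = f.[a], 0 < P (fx - fconst a) & 0 < P (fy - fconst b)].

Definition rational_point (K0 : divringClosed K) (P : point) : Prop :=
  at_infinity P \/
  exists a b : K, [/\ a \in K0, b \in K0 & at_affine P a b].

(* The divisors of interest are finite combinations of points. *)
Definition divisor := point -> int.

Definition div_point (P : point) : divisor := fun Q => (`[< Q = P >])%:R.

Definition div_fun (g : funfield) : divisor := fun Q => Q g.

Definition principal (D : divisor) : Prop :=
  exists2 g : funfield, g != 0 & D = div_fun g.

(* A degree zero divisor representing the image of P under the embedding
   C_{f,d} -> J(C_{f,d}) that sends O to 0, where J(C_{f,d})(K) is the group
   of degree zero divisors modulo principal divisors. *)
Definition abel_jacobi (O P : point) : divisor :=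
  fun Q => div_point P Q - div_point O Q.

Definition has_order (O P : point) (m : nat) : Prop :=
  [/\ (0 < m)%N,
      principal (fun Q => abel_jacobi O P Q *+ m) &
      forall k : nat, (0 < k < m)%N ->
        ~ principal (fun Q => abel_jacobi O P Q *+ k)].

End Curve.

Definition degree_n_sqfree_over (K : closedFieldType) (K0 : divringClosed K)
    (n : nat) (f : {poly K}) : Prop :=
  [/\ f \is a polyOver K0, size f = n.+1 & no_repeated_roots f].

Definition reachable (K : closedFieldType) (K0 : divringClosed K)
    (n d m : nat) : Prop :=
  (1 < m)%N /\
  exists f : {poly K}, degree_n_sqfree_over K0 n f /\
  exists O P : point d f,
    [/\ at_infinity O, rational_point K0 P & has_order O P m].

(* An isomorphism C_{f,d} -> C_{g,d} over K is given contravariantly by an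
   isomorphism K(C_{g,d}) -> K(C_{f,d}) of K-algebras (composition of functions
   with it); it sends P to Q when ord_P (phi h) = ord_Q h for all h. *)
Definition curve_isom (K : closedFieldType) (d : nat) (f g : {poly K})
    (phi : {rmorphism funfield d g -> funfield d f}) : Prop :=
  bijective phi /\ forall c : K, phi (fconst d g c) = fconst d f c.

Definition isom_maps (K : closedFieldType) (d : nat) (f g : {poly K})
    (phi : {rmorphism funfield d g -> funfield d f})
    (P : point d f) (Q : point d g) : Prop :=
  forall h : funfield d g, P (phi h) = Q h.

Definition f0 (K : closedFieldType) (n d : nat) : {poly K} :=
  - 'X^(m0 n d) + ('X^(ell0 n d) + 1) ^+ d.

(* Main.v *)
(* Put l = ell0 n d, so that n = (d - 1) l with 1 < l < d.

   Points of the curve are handled through filtrations of the function field: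
   by the weighted degree (x of weight d, y of weight n) at infinity, and by the
   powers of a uniformizer of the local ring at an affine point.  In each case
   every nonzero element has a leading term, which gives the valuation and shows
   that it is the only one at that place.  As the curve is smooth, a function
   without poles at the affine points is a polynomial in x and y.

   If m (P - O) with m = d l is the divisor of g, then g has pole order d l at O,
   so that g = c y + w(x) with deg w <= l.  If c = 0, then w is a power of x - a,
   where P = (a, b), and P has order at most d.  Otherwise let c = 1 and u = - w;
   then f - u^d vanishes only at a, so that f = u^d - (lam (x - a)^l)^d.
   Comparing degrees, u = lam (x - a)^l + b.  Such an f has no repeated roots
   exactly when l is nonzero in K, and it becomes f0 after x := s (x - a),
   y := y / b with s^l = lam / b.

   Conversely y - (x^l + 1) has divisor d l (Q - O) on the curve of f0; a function
   with divisor k (Q - O) and 0 < k < d l must have k = n, and dividing the two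
   would give such a function for k = l < n. *)
Require Import Defs.
From HB Require Import structures.
From mathcomp Require Import all_boot all_order all_algebra.
From mathcomp Require Import separable.
From mathcomp Require Import boolp.
From mathcomp Require Import zify ring.
Set Implicit Arguments.
Unset Strict Implicit.
Unset Printing Implicit Defensive.
Import Order.TTheory GRing.Theory Num.Theory.
Local Open Scope ring_scope.

(** * Filtrations and valuations *)

(** Points are arbitrary normalized valuations of [funfield], so constructing one valuation at each
    place is not enough: any other valuation with the same centre has to be compared with it. A
    priori such a valuation is bounded below only by s times the filtration degree, for an unknown s
    > 0 (a ramification index). Applying this bound to a leading unit and to its inverse turns it
    into an equality, and surjectivity onto Z then forces s = 1.

    A second obstacle is that [funfield] is not known to be a field at the start. The filtration at
    infinity is therefore built in a ring where only the nonzero elements of K[x] are known to be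
    invertible. The existence of leading terms excludes zero divisors, and this takes the place of a
    separate proof that Y^d - f is irreducible over K(x). *)

Section Filtration.

Variables (L : comNzRingType) (Fil : int -> L -> Prop).

(** [fil_one] is the nondegeneracy condition that makes the degree of a leading term well defined: a
    unit in degree r + 1 whose inverse is in degree - r would put 1 in degree 1. *)
Record filtration : Prop := Filtration {
  fil_zero : forall r, Fil r 0;
  fil_anti : forall r s g, r <= s -> Fil s g -> Fil r g;
  fil_sub : forall r g h, Fil r g -> Fil r h -> Fil r (g - h);
  fil_mul : forall r s g h, Fil r g -> Fil s h -> Fil (r + s) (g * h);
  fil_one : ~ Fil 1 1 }.

(* The class of [g] in the associated graded ring is that of a unit [u] of the
   same degree. *)
Definition leading (r : int) (g : L) : Prop :=
  exists u u', [/\ u * u' = 1, Fil r u, Fil (- r) u' & Fil (r + 1) (g - u)].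

Hypothesis Fil_filtration : filtration.

Lemma fil_opp r g : Fil r g -> Fil r (- g).
Proof.
by move=> Fg; rewrite -sub0r; apply: fil_sub (fil_zero _ _) _.
Qed.

Lemma fil_add r g h : Fil r g -> Fil r h -> Fil r (g + h).
Proof.
by move=> Fg Fh; rewrite -[h]opprK; apply: fil_sub Fg (fil_opp Fh).
Qed.

Lemma leading_fil r g : leading r g -> Fil r g.
Proof.
case=> u [u' [_ Fu _ Fgu]]; rewrite -[g](subrK u); apply: fil_add => //.
by apply: fil_anti Fgu => //; rewrite lerDl.
Qed.

Lemma leading_max r s g : leading r g -> Fil s g -> s <= r.
Proof.
case=> u [u' [uu' Fu Fu' Fgu]] Fg; rewrite leNgt -lezD1; apply/negP => ltrs.
have Fu1 : Fil (r + 1) u.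
  by rewrite -[u](subKr g); apply: fil_sub => //; apply: fil_anti Fg.
case: (fil_one Fil_filtration); rewrite -uu'.
by have := fil_mul Fil_filtration Fu1 Fu'; rewrite addrAC subrr add0r.
Qed.

Lemma leading_inj r s g : leading r g -> leading s g -> r = s.
Proof.
move=> lr ls; apply/le_anti.
by rewrite (leading_max ls (leading_fil lr))
           (leading_max lr (leading_fil ls)).
Qed.

Lemma leading_neq0 r g : leading r g -> g != 0.
Proof.
move=> lr; apply/eqP => g0; rewrite g0 in lr.
have := leading_max lr (fil_zero Fil_filtration (r + 1)).
by rewrite gerDl.
Qed.

Lemma leading_mul r s g h :
  leading r g -> leading s h -> leading (r + s) (g * h).
Proof.
move=> lr ls; have Fh := leading_fil ls.
case: lr ls => u [u' [uu' Fu Fu' Fgu]] [w [w' [ww' Fw Fw' Fhw]]].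
exists (u * w), (u' * w'); split.
- by rewrite mulrACA uu' ww' mulr1.
- exact: fil_mul.
- by rewrite opprD; apply: fil_mul.
have -> : g * h - u * w = (g - u) * h + u * (h - w) by ring.
apply: fil_add.
- by rewrite -addrA [s + 1]addrC addrA; apply: fil_mul.
- by rewrite -addrA; apply: fil_mul.
Qed.

Hypothesis leading_ex : forall g : L, g != 0 -> exists r, leading r g.

Lemma filtration_domain (g h : L) : g != 0 -> h != 0 -> g * h != 0.
Proof.
move=> /leading_ex[r lr] /leading_ex[s ls].
exact: leading_neq0 (leading_mul lr ls).
Qed.

Lemma filtration_ord : exists v : L -> int,
  v 0 = 0 /\ forall r g, leading r g -> v g = r.
Proof.
(* By [leading_neq0], 0 has no leading term, so the default of the conditional is its value. *)
exists (fun g => if pselect (exists r, leading r g) is left e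
                 then projT1 (cid e) else 0); split => [|r g lr].
- case: pselect => // e; case: (cid e) => r /= /leading_neq0.
  by rewrite eqxx.
- case: pselect => [e|]; last by case; exists r.
  by case: (cid e) => s /= ls; apply: leading_inj lr.
Qed.

End Filtration.

(** The outer variable is y and the inner one is x: [beta 'X] is y and [beta 'X%:P] is x.
    Denominators can be taken in K[x] and numerators of degree less than d in y. [L] is only a ring
    with units, so that the record can be established for [funfield] before it is known to be a
    field. *)
Record function_field (K : fieldType) (d : nat) (f : {poly K})
    (L : comUnitRingType) (beta : {rmorphism {poly {poly K}} -> L}) : Prop :=
  FunctionField {
  ff_frac : forall g, exists (q : {poly K}) (p : {poly {poly K}}),
    [/\ q != 0, (size p <= d)%N & beta q%:P * g = beta p];
  ff_unit : forall q : {poly K}, q != 0 -> beta q%:P \is a GRing.unit;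
  ff_ker : forall p, beta p = 0 <-> exists u : {poly {poly K}}, p = ('X^d - f%:P) * u }.

(** * Weighted degree of polynomials in x and y *)

Section Weight.

Variables (K : fieldType) (n d : nat).
Implicit Types p : {poly {poly K}}.

(* In the weighted degree [x] has weight [d] and [y] has weight [n], their pole
   orders at infinity. *)
Definition weight_le p (D : int) : Prop :=
  forall i j, p`_j`_i != 0 -> (d * i + n * j)%:Z <= D.

Lemma weight_le0 D : weight_le 0 D.
Proof. by move=> i j; rewrite !coef0 eqxx. Qed.

Lemma weight_le_trans p D E : D <= E -> weight_le p D -> weight_le p E.
Proof. by move=> leDE pD i j /pD /le_trans; apply. Qed.

Lemma weight_leB p q D : weight_le p D -> weight_le q D -> weight_le (p - q) D.
Proof.
move=> pD qD i j; rewrite !coefB => pq.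
have [p0|/pD //] := eqVneq p`_j`_i 0.
by apply: qD; move: pq; rewrite p0 sub0r oppr_eq0.
Qed.

Lemma weight_leD p q D : weight_le p D -> weight_le q D -> weight_le (p + q) D.
Proof.
move=> pD qD; rewrite -[q]opprK -[- q]sub0r.
by apply: weight_leB => //; apply: weight_leB => //; apply: weight_le0.
Qed.

Lemma weight_leM p q D E :
  weight_le p D -> weight_le q E -> weight_le (p * q) (D + E).
Proof.
move=> pD qE i j; rewrite coefM coef_sum => nz.
suff [j1 [j2 [i1 [i2 [ej ei p1 q2]]]]] : exists j1 j2 i1 i2,
    [/\ (j1 + j2 = j)%N, (i1 + i2 = i)%N, p`_j1`_i1 != 0 & q`_j2`_i2 != 0].
  by have := pD _ _ p1; have := qE _ _ q2; rewrite -ej -ei; lia.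
apply: contrapT => none; move/eqP: nz; apply.
apply: big1 => j1 _; rewrite coefM; apply: big1 => i1 _.
have [->|p1] := eqVneq p`_j1`_i1 0; first by rewrite mul0r.
have [->|q2] := eqVneq q`_(j - j1)`_(i - i1) 0; first by rewrite mulr0.
case: none; exists j1, (j - j1)%N, i1, (i - i1)%N; split=> //.
- by rewrite subnKC // -ltnS.
- by rewrite subnKC // -ltnS.
Qed.

Lemma weight_leC (q : {poly K}) s : (size q <= s.+1)%N ->
  weight_le q%:P (d * s)%N%:Z.
Proof.
move=> sq i [|j]; rewrite coefC /= ?coef0 ?eqxx // => qi.
have : (i < size q)%N by apply: contraR qi; rewrite -leqNgt => /leq_sizeP->.
rewrite muln0 addn0 lez_nat leq_mul2l => lti.
by rewrite -ltnS (leq_trans lti sq) orbT.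
Qed.

Lemma weight_leXn j : weight_le 'X^j (n * j)%N%:Z.
Proof.
move=> i k; rewrite coefXn; have [->|_] := eqVneq k j; last by rewrite coef0 eqxx.
by case: i => [|i]; rewrite coef1 ?eqxx // muln0.
Qed.

Lemma weight_le_monomial (c : K) i j :
  weight_le ((c *: 'X^i)%:P * 'X^j) (d * i + n * j)%N%:Z.
Proof.
rewrite PoszD; apply: weight_leM; last exact: weight_leXn.
by apply: weight_leC; rewrite (leq_trans (size_scale_leq _ _)) // size_polyXn.
Qed.

Lemma coef_monomial (c : K) i j k l :
  ((c *: 'X^i)%:P * 'X^j)`_l`_k = c * ((l == j) && (k == i))%:R.
Proof.
rewrite coefCM coefXn; case: (l == j) => /=; last by rewrite mulr0 coef0 mulr0.
by rewrite mulr1 coefZ coefXn.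
Qed.

Lemma weight_le_ex p : exists D : nat, weight_le p D%:Z.
Proof.
exists (d * (\max_(j < size p) size (p`_j)%R) + n * size p)%N => i j pij.
have ltj : (j < size p)%N.
  by apply: contraR pij; rewrite -leqNgt => /leq_sizeP->; rewrite ?coef0.
have lti : (i < size (p`_j)%R)%N.
  by apply: contraR pij; rewrite -leqNgt => /leq_sizeP->.
rewrite lez_nat leq_add // leq_mul2l ?(ltnW ltj) ?orbT //.
apply/orP; right; apply: leq_trans (ltnW lti) _.
exact: (leq_bigmax (Ordinal ltj)).
Qed.

Lemma weight_top p : p != 0 -> exists i j,
  p`_j`_i != 0 /\ weight_le p (d * i + n * j)%N%:Z.
Proof.
move=> p0.
have exD : exists D : nat, `[< weight_le p D%:Z >].
  by have [D pD] := weight_le_ex p; exists D; apply/asboolP.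
case: (ex_minnP exD) => D /asboolP pD minD.
suff [i [j [pij lej]]] : exists i j, p`_j`_i != 0 /\ (D <= d * i + n * j)%N.
  exists i, j; split=> //; apply: weight_le_trans pD.
  by rewrite lez_nat.
apply: contrapT => none.
have lt_none i j : p`_j`_i != 0 -> (d * i + n * j < D)%N.
  by move=> pij; rewrite ltnNge; apply/negP => leD; apply: none; exists i, j.
case: D => [|D] in pD minD lt_none none *.
- have lp0 : lead_coef (lead_coef p) != 0 by rewrite !lead_coef_eq0.
  by have := lt_none _ _ lp0.
- have /minD : `[< weight_le p D%:Z >].
    by apply/asboolP => i j /lt_none; rewrite ltnS lez_nat.
  by rewrite ltnn.
Qed.

(** Modulo d the equality says that d divides n (j - l), hence j - l by coprimality, while j and l
    are both less than d. *)
Lemma weight_inj i j k l : coprime n d -> (j < d)%N -> (l < d)%N ->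
  (d * i + n * j = d * k + n * l)%N -> i = k /\ j = l.
Proof.
move=> cnd ltj ltl e.
have d0 : (0 < d)%N by apply: leq_ltn_trans ltj.
have ejl : j = l.
  wlog lejl : i j k l ltj ltl e / (l <= j)%N.
    move=> W; have [/W H|/ltnW/W H] := leqP l j; first exact: (H i k).
    exact/esym/(H k i).
  move: e => /eqP; rewrite -(subnKC lejl) mulnDr; move: (j - l)%N (leq_subr l j) => t let_.
  move=> /eqP e; have : (d %| n * t)%N.
    have -> : (n * t = d * (k - i))%N by nia.
    exact: dvdn_mulr.
  rewrite Gauss_dvdr 1?coprime_sym // => /dvdn_leq; case: t => [|t] in let_ e *.
    by rewrite addn0.
  by move=> /(_ isT); lia.
split=> //; move: e; rewrite ejl => /addIn /eqP.
by rewrite eqn_mul2l => /orP[/eqP d00|/eqP//]; rewrite d00 in d0.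
Qed.

End Weight.

Lemma size_poly_neq0 (R : nzRingType) (p : {poly R}) k : size p = k.+1 -> p != 0.
Proof. by rewrite -size_poly_eq0 => ->. Qed.

Lemma pred_size_mul (R : idomainType) (p q : {poly R}) : p != 0 -> q != 0 ->
  (size (p * q)).-1 = ((size p).-1 + (size q).-1)%N.
Proof.
move=> p0 q0; rewrite size_mul //; move: p0 q0; rewrite -!size_poly_gt0.
by case: (size p) => // a _; case: (size q) => // b _; rewrite addnS.
Qed.

(** * The filtration by pole order at infinity *)

Section Infinity.

Variables (K : fieldType) (n d : nat) (f : {poly K}).
Hypotheses (d_gt0 : (0 < d)%N) (coprime_nd : coprime n d).
Hypothesis size_f : size f = n.+1.

Local Notation wle := (weight_le n d).
Local Notation C := ('X^d - f%:P : {poly {poly K}}).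

Lemma curve_poly_monic : C \is monic.
Proof. by rewrite -['X^d]expr1 monicXnsubC. Qed.

Lemma size_curve_poly : size C = d.+1.
Proof. exact: size_XnsubC. Qed.

(** Replacing y^d by f does not raise the weight, because both weigh n d; the highest power of y is
    rewritten in this way until the degree in y is less than d. *)
Lemma weight_reduce (p : {poly {poly K}}) D : wle p D ->
  exists2 p' : {poly {poly K}}, (size p' <= d)%N /\ wle p' D & exists u : {poly {poly K}}, p = p' + C * u.
Proof.
have [m] := ubnP (size p); elim: m p => // m IH p ltpm pD.
have [led|ltd] := leqP (size p) d.
  by exists p => //; exists 0; rewrite mulr0 addr0.
have [s sp] : {s | size p = s.+1} by case: (size p) ltd => // s; exists s.
have leds : (d <= s)%N by rewrite -ltnS -sp.
pose t := (p`_s)%:P * 'X^(s - d).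
have tD : wle t (D - (n * d)%N%:Z).
  move=> i j; rewrite coefCM coefXn; have [->|_] := eqVneq j (s - d)%N; last first.
    by rewrite mulr0 coef0 eqxx.
  rewrite mulr1 => /pD; rewrite mulnBr; nia.
have fD : wle f%:P (d * n)%N by apply: weight_leC; rewrite size_f.
case: (IH (p - t * C)) => [||p' p'P [u pE]].
- rewrite ltnS in ltpm; apply: leq_trans ltpm; rewrite sp ltnS.
  apply/leq_sizeP => j lesj; rewrite mulrBr -mulrA -exprD subnK // !coefB.
  rewrite coefMC !coefCM !coefXn.
  have [->|neq_js] := eqVneq j s.
    rewrite mulr1 gtn_eqF ?mulr0 ?mul0r ?subr0 ?subrr //.
    by rewrite ltn_subrL d_gt0 (leq_trans d_gt0 leds).
  rewrite gtn_eqF; last by rewrite (leq_trans _ lesj) // ltn_subrL d_gt0 (leq_trans d_gt0 leds).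
  have ltsj : (s < j)%N by rewrite ltn_neqAle eq_sym neq_js.
  rewrite (nth_default _ (_ : size p <= j)%N) ?sp //.
  by rewrite !mulr0 mul0r !subr0.
- apply: weight_leB => //; rewrite mulrBr; apply: weight_leB.
    by rewrite -[D](subrK (n * d)%N%:Z); apply: weight_leM => //; apply: weight_leXn.
  by rewrite -[D](subrK (d * n)%N%:Z); apply: weight_leM => //; rewrite mulnC.
exists p' => //; exists (u + t).
by rewrite mulrDr addrA -pE [C * t]mulrC subrK.
Qed.

Variables (L : comUnitRingType) (beta : {rmorphism {poly {poly K}} -> L}).
Hypothesis ffL : function_field d f beta.

Lemma ff_eqn : beta 'X ^+ d = beta f%:P.
Proof.
apply/eqP; rewrite -subr_eq0 -rmorphXn -rmorphB; apply/eqP.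
by apply/(ff_ker ffL); exists 1; rewrite mulr1.
Qed.

Lemma ff_small_eq0 (p : {poly {poly K}}) : (size p <= d)%N -> beta p = 0 -> p = 0.
Proof.
move=> sp /(ff_ker ffL)[u pE]; have [u0|u0] := eqVneq u 0.
  by rewrite pE u0 mulr0.
move: sp; rewrite pE mulrC size_Mmonic ?curve_poly_monic // size_curve_poly.
by rewrite addnS /= -[X in (_ <= X)%N]add0n leq_add2r leqn0 size_poly_eq0 (negPf u0).
Qed.

(** The fraction p / q should vanish at infinity to order at least d deg q minus the weight of p.
    The numerator need not be reduced in y, so that closure under products is immediate; reduction
    enters only through [fil_infty_one]. *)
Definition fil_infty (r : int) (g : L) : Prop :=
  exists (q : {poly K}) (p : {poly {poly K}}),
    [/\ q != 0, beta q%:P * g = beta p & wle p ((d * (size q).-1)%N%:Z - r)].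

(** After reduction the numerator of 1 = p / q is q itself, whose weight is d deg q, one more than
    the bound allows. *)
Lemma fil_infty_one : ~ fil_infty 1 1.
Proof.
case=> q [p [q0 e pD]]; rewrite mulr1 in e.
have [p' [sp' p'D] [u pE]] := weight_reduce pD.
have /eqP : p' - q%:P = 0.
  apply: ff_small_eq0.
    rewrite (leq_trans (size_polyD _ _)) // geq_max sp' size_polyN.
    by rewrite (leq_trans (size_polyC_leq1 _)).
  rewrite rmorphB e pE rmorphD opprD addrA subrr sub0r; apply/eqP.
  by rewrite oppr_eq0; apply/eqP/(ff_ker ffL); exists u.
rewrite subr_eq0 => /eqP p'E.
have := p'D (size q).-1 0%N; rewrite p'E coefC /= -lead_coefE lead_coef_eq0.
by move=> /(_ q0); lia.
Qed.

Lemma fil_infty_filtration : filtration fil_infty.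
Proof.
split.
- move=> r; exists 1, 0; split; rewrite ?oner_neq0 ?mulr0 ?rmorph0 //.
  exact: weight_le0.
- move=> r s g lers [q [p [q0 e pD]]]; exists q, p; split=> //.
  by apply: weight_le_trans pD; rewrite lerD2l lerN2.
- move=> r g h [q [p [q0 e pD]]] [q' [p' [q'0 e' p'D]]].
  have sqq : (size (q * q')).-1 = ((size q).-1 + (size q').-1)%N.
    exact: pred_size_mul.
  exists (q * q'), (p * q'%:P - p' * q%:P); split; first by rewrite mulf_neq0.
    by rewrite polyCM rmorphB !rmorphM -e -e'; ring.
  rewrite sqq mulnDr PoszD; apply: weight_leB.
    rewrite addrAC; apply: weight_leM => //.
    by apply: weight_leC; rewrite leqSpred.
  rewrite -addrA addrC; apply: weight_leM => //.
  by apply: weight_leC; rewrite leqSpred.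
- move=> r s g h [q [p [q0 e pD]]] [q' [p' [q'0 e' p'D]]].
  have sqq : (size (q * q')).-1 = ((size q).-1 + (size q').-1)%N.
    exact: pred_size_mul.
  exists (q * q'), (p * p'); split; first by rewrite mulf_neq0.
    by rewrite polyCM !rmorphM -e -e'; ring.
  by rewrite sqq mulnDr PoszD opprD addrACA; apply: weight_leM.
- exact: fil_infty_one.
Qed.

(* The weights of the monomials [x^i y^j] with [j < d] are distinct, so that the
   top one is a leading term. *)
Lemma leading_infty (g : L) (q : {poly K}) (p : {poly {poly K}}) i j :
  q != 0 -> (size p <= d)%N -> beta q%:P * g = beta p ->
  p`_j`_i != 0 -> wle p (d * i + n * j)%N ->
  leading fil_infty ((d * (size q).-1)%N%:Z - (d * i + n * j)%N%:Z) g.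
Proof.
move=> q0 sp e pij pD; set s := (size q).-1; set D := (d * i + n * j)%N.
have sq : (size q <= s.+1)%N by rewrite leqSpred.
have ltjd : (j < d)%N.
  apply: leq_trans sp; apply: contraR pij; rewrite -leqNgt => /leq_sizeP-> //.
  by rewrite coef0.
pose q1 : {poly K} := lead_coef q *: 'X^s.
pose x1 : {poly K} := p`_j`_i *: 'X^i.
pose M : {poly {poly K}} := x1%:P * 'X^j.
have q1_neq0 : q1 != 0 by rewrite scaler_eq0 negb_or lead_coef_eq0 q0 -size_poly_eq0 size_polyXn.
have x1_neq0 : x1 != 0 by rewrite scaler_eq0 negb_or pij -size_poly_eq0 size_polyXn.
have sq1 : (size q1).-1 = s by rewrite size_scale ?lead_coef_eq0 // size_polyXn.
have uq1 := ff_unit ffL q1_neq0.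
have ux1 := ff_unit ffL x1_neq0.
have f_neq0 := size_poly_neq0 size_f.
have uf := ff_unit ffL f_neq0.
have MD : wle M D by apply: weight_le_monomial.
have q1D : wle q1%:P (d * s)%N.
  by apply: weight_leC; rewrite (leq_trans (size_scale_leq _ _)) // size_polyXn.
(* As only elements of K[x] are known to be invertible, the inverse of x1 y^j is written y^(d - j) /
   (f x1), by y^d = f. *)
exists (beta M / beta q1%:P), (beta 'X^(d - j) * beta q1%:P / (beta f%:P * beta x1%:P)).
have E1 : beta M * beta 'X^(d - j) = beta f%:P * beta x1%:P.
  by rewrite -ff_eqn -rmorphXn -!rmorphM /= /M -mulrA -exprD subnKC 1?ltnW // mulrC.
have ufx : beta f%:P * beta x1%:P \is a GRing.unit by rewrite unitrM uf.
split.
- rewrite mulrA [_ / _ * _]mulrAC mulrA E1.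
  by rewrite -[_ * beta q1%:P / _]mulrA divrr // mulr1 divrr.
- exists q1, M; split=> //; first by rewrite mulrC divrK.
  by rewrite sq1 opprB addrCA subrr addr0.
- exists (f * x1), ('X^(d - j) * q1%:P); split; first by rewrite mulf_neq0.
    by rewrite !rmorphM /= mulrC divrK // -rmorphM.
  have -> : (d * (size (f * x1)%R).-1)%N%:Z - - ((d * s)%N%:Z - D%:Z)
     = (n * (d - j))%N%:Z + (d * s)%N%:Z.
    rewrite size_mul // size_f size_scale // size_polyXn /D mulnBr.
    by have := leq_mul (leqnn n) (ltnW ltjd); nia.
  by apply: weight_leM => //; apply: weight_leXn.
exists (q * q1), (p * q1%:P - M * q%:P); split; first by rewrite mulf_neq0.
  have eM : beta M = beta M / beta q1%:P * beta q1%:P by rewrite divrK.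
  rewrite polyCM [RHS]rmorphB [beta (_ * _%:P)]rmorphM [beta (p * _)]rmorphM.
  by rewrite [beta (M * _)]rmorphM -e [in RHS]eM; ring.
have -> : (d * (size (q * q1)%R).-1)%N%:Z - ((d * s)%N%:Z - D%:Z + 1) =
   (D%:Z - 1) + (d * s)%N%:Z.
  have -> : (size (q * q1)%R).-1 = (s + s)%N.
    by rewrite pred_size_mul // sq1.
  by rewrite mulnDr PoszD; ring.
(* [p - M] has lost its top monomial, and no other monomial has that weight; [q1 - q] has lost its
   leading term. Each summand therefore weighs at most D + d s - 1. *)
have -> : p * q1%:P - M * q%:P = (p - M) * q1%:P + M * (q1 - q)%:P.
  by rewrite rmorphB /=; ring.
apply: weight_leD.
  apply: weight_leM => // k l; rewrite !coefB coef_monomial => nz.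
  have pkl : p`_l`_k != 0.
    apply: contraNN nz => /eqP pkl; rewrite pkl.
    have [/andP[/eqP lj /eqP ki]|_] := boolP ((l == j) && (k == i)).
      by move: pij; rewrite -lj -ki pkl eqxx.
    by rewrite mulr0 subr0.
  have ltld : (l < d)%N.
    apply: leq_trans sp; apply: contraR pkl; rewrite -leqNgt => /leq_sizeP-> //.
    by rewrite coef0.
  have := pD _ _ pkl; rewrite lez_nat leq_eqVlt => /orP[/eqP|]; last by rewrite /D; lia.
  move=> /(weight_inj coprime_nd ltld ltjd)[ki lj].
  by move: nz; rewrite ki lj !eqxx mulr1 subrr eqxx.
have -> : D%:Z - 1 + (d * s)%N%:Z = D%:Z + ((d * s)%N%:Z - 1) by ring.
apply: weight_leM => // k l; rewrite coefC; case: l => [|l]; last by rewrite coef0 eqxx.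
rewrite /= coefB coefZ coefXn; have [->|neq_ks] := eqVneq k s.
  by rewrite mulr1 lead_coefE subrr eqxx.
rewrite mulr0 sub0r oppr_eq0 => qk.
have : (k < size q)%N by apply: contraR qk; rewrite -leqNgt => /leq_sizeP->.
move=> ltk; have : (k < s)%N by rewrite ltn_neqAle neq_ks; rewrite /s; lia.
by nia.
Qed.

Lemma leading_infty_ex (g : L) : g != 0 -> exists r, leading fil_infty r g.
Proof.
move=> g0; have [q [p [q0 sp e]]] := ff_frac ffL g.
have p0 : p != 0.
  apply: contraNneq g0 => p0; move: e; rewrite p0 rmorph0 => e.
  by rewrite -[g](mulKr (ff_unit ffL q0)) e mulr0.
by have [i [j [pij pD]]] := weight_top n d p0; eexists; exact: leading_infty q0 sp e pij pD.
Qed.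

(** This carries the irreducibility of the curve equation: coprimality of n and d enters through the
    distinct weights of the monomials. *)
Lemma ff_domain (g h : L) : g != 0 -> h != 0 -> g * h != 0.
Proof. exact: filtration_domain fil_infty_filtration leading_infty_ex _ _. Qed.

End Infinity.

(** * Normalized valuations, determined by leading terms *)

Section Valuation.

Variables (K : fieldType) (L : fieldType).
Variable beta : {rmorphism {poly {poly K}} -> L}.

Record valuation (v : L -> int) : Prop := Valuation {
  val_zero : v 0 = 0;
  valM : forall g h, g != 0 -> h != 0 -> v (g * h) = v g + v h;
  val_min : forall g h, g != 0 -> h != 0 -> g + h != 0 ->
    Num.min (v g) (v h) <= v (g + h);
  valC : forall c : K, v (beta c%:P%:P) = 0;
  val_onto : exists t, v t = 1 }.

(** As [v 0 = 0] is a convention, the first alternative restores the infinite order of 0, which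
    makes these sets closed under sums. *)
Definition val_ge (v : L -> int) (k : int) (g : L) : Prop := g = 0 \/ k <= v g.

Section Facts.

Variables (v : L -> int) (v_val : valuation v).

Lemma val_geE k g : g != 0 -> val_ge v k g -> k <= v g.
Proof. by move=> g0 [g00|//]; rewrite g00 eqxx in g0. Qed.

Lemma val_one : v 1 = 0.
Proof. by rewrite -(valC v_val 1) !rmorph1. Qed.

Lemma valN g : v (- g) = v g.
Proof.
have [->|g0] := eqVneq g 0; first by rewrite oppr0.
have := valC v_val (-1); rewrite !rmorphN1 => vN1.
by rewrite -mulN1r (valM v_val) // ?oppr_eq0 ?oner_neq0 // vN1 add0r.
Qed.

Lemma valX g k : g != 0 -> v (g ^+ k) = k%:Z * v g.
Proof.
move=> g0; elim: k => [|k IH]; first by rewrite mul0r val_one.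
by rewrite exprS (valM v_val) ?expf_neq0 // IH -addn1 PoszD mulrDl mul1r addrC.
Qed.

Lemma valV g : g != 0 -> v g^-1 = - v g.
Proof.
move=> g0; apply/eqP; rewrite -addr_eq0 -(valM v_val) ?invr_eq0 //.
by rewrite mulVf // val_one.
Qed.

Lemma valXz g (r : int) : g != 0 -> v (g ^ r) = r * v g.
Proof.
move=> g0; case: r => k; first exact: valX.
by rewrite NegzE -exprz_inv -exprnP valX ?invr_eq0 // valV // mulrN mulNr.
Qed.

Lemma val_ge_trans k l g : k <= l -> val_ge v l g -> val_ge v k g.
Proof. by move=> lekl [->|lelg]; [left | right; apply: le_trans lelg]. Qed.

Lemma val_geD k g h : val_ge v k g -> val_ge v k h -> val_ge v k (g + h).
Proof.
move=> [->|kg]; first by rewrite add0r.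
move=> [->|kh]; first by rewrite addr0; right.
have [gh0|gh0] := eqVneq (g + h) 0; first by left.
have [g0|g0] := eqVneq g 0; first by rewrite g0 add0r; right.
have [h0|h0] := eqVneq h 0; first by rewrite h0 addr0; right.
right; apply: le_trans (val_min v_val g0 h0 gh0).
by rewrite le_min kg kh.
Qed.

Lemma val_geN k g : val_ge v k g -> val_ge v k (- g).
Proof. by move=> [->|kg]; [left; rewrite oppr0 | right; rewrite valN]. Qed.

Lemma val_geB k g h : val_ge v k g -> val_ge v k h -> val_ge v k (g - h).
Proof. by move=> kg kh; apply: val_geD => //; apply: val_geN. Qed.

Lemma val_geM k l g h : val_ge v k g -> val_ge v l h -> val_ge v (k + l) (g * h).
Proof.
move=> [->|kg]; first by left; rewrite mul0r.
move=> [->|lh]; first by left; rewrite mulr0.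
have [->|g0] := eqVneq g 0; first by left; rewrite mul0r.
have [->|h0] := eqVneq h 0; first by left; rewrite mulr0.
by right; rewrite (valM v_val) // lerD.
Qed.

Lemma val_geC (c : K) : val_ge v 0 (beta c%:P%:P).
Proof. by right; rewrite (valC v_val). Qed.

Lemma val_ge_sum I (r : seq I) (P : pred I) (F : I -> L) k :
  (forall i, P i -> val_ge v k (F i)) -> val_ge v k (\sum_(i <- r | P i) F i).
Proof.
move=> FP; elim/big_rec: _ => [|i g Pi kg]; first by left.
by apply: val_geD => //; apply: FP.
Qed.

Lemma val_dominant g h : g != 0 -> val_ge v (v g + 1) h ->
  g + h != 0 /\ v (g + h) = v g.
Proof.
move=> g0 [->|gh]; first by rewrite addr0.
have gh0 : g + h != 0.
  apply/eqP => /eqP; rewrite addr_eq0 => /eqP gE.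
  by move: gh; rewrite gE valN; lia.
split=> //; apply/le_anti/andP; split; last first.
  suff [gh0'|//] : val_ge v (v g) (g + h) by rewrite gh0' eqxx in gh0.
  by apply: val_geD; right; lia.
rewrite leNgt; apply/negP => ltv.
have : val_ge v (v g + 1) (g + h - h).
  by apply: val_geB; right; lia.
by rewrite addrK => /(val_geE g0); lia.
Qed.

End Facts.

(** For a leading unit u of degree r with inverse u', the bounds s r on v u and - s r on v u' add up
    to v 1 = 0, so both are attained; the remainder g - u has larger order. Hence v is s times the
    degree, and an element of order 1 gives s = 1. *)
Lemma valuation_unique (Fil : int -> L -> Prop) (v : L -> int) (s : int) :
    (forall g, g != 0 -> exists r, leading Fil r g) -> valuation v -> 0 < s ->
    (forall r g, Fil r g -> val_ge v (s * r) g) ->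
  s = 1 /\ forall r g, leading Fil r g -> v g = r.
Proof.
move=> lead_ex v_val s0 Fil_v.
have vE r g : leading Fil r g -> v g = s * r.
  case=> u [u' [uu' /Fil_v Fu /Fil_v Fu' /Fil_v Fgu]].
  have u0 : u != 0.
    by apply: contraTneq (oner_neq0 L) => u0; rewrite -uu' u0 mul0r eqxx.
  have u'0 : u' != 0.
    by apply: contraTneq (oner_neq0 L) => u0'; rewrite -uu' u0' mulr0 eqxx.
  have vuu' : v u + v u' = 0 by rewrite -(valM v_val) // uu' (val_one v_val).
  have := val_geE u0 Fu; have := val_geE u'0 Fu' => leu' leu.
  have vu : v u = s * r by apply/le_anti; lia.
  have [|_] := val_dominant v_val u0 (h := g - u); last by rewrite addrC subrK vu.
  by apply: val_ge_trans Fgu; rewrite vu mulrDr mulr1; lia.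
have [t vt] := val_onto v_val.
have t0 : t != 0.
  by apply/eqP => t0; move: vt; rewrite t0 (val_zero v_val).
have [r /vE vtr] := lead_ex t t0.
have s1 : s = 1.
  have r0 : 0 < r by rewrite -(pmulr_rgt0 _ s0) -vtr vt.
  by move: vtr; rewrite vt => e1; nia.
by split=> // q g /vE; rewrite s1 mul1r.
Qed.

Lemma valuation_exists (Fil : int -> L -> Prop) :
    filtration Fil ->
    (forall g, g != 0 -> exists r, leading Fil r g) ->
    (forall c : K, c != 0 -> leading Fil 0 (beta c%:P%:P)) ->
    (exists t, leading Fil 1 t) ->
  exists2 v, valuation v & forall r g, leading Fil r g -> v g = r.
Proof.
move=> FilP lead_ex leadC [t lead_t].
have [v [v0 vE]] := filtration_ord FilP.
exists v => //; split=> //.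
- move=> g h /lead_ex[r lr] /lead_ex[s ls].
  by rewrite (vE _ _ lr) (vE _ _ ls) (vE _ _ (leading_mul FilP lr ls)).
- move=> g h /lead_ex[r lr] /lead_ex[s ls] /lead_ex[q lq].
  rewrite (vE _ _ lr) (vE _ _ ls) (vE _ _ lq); apply: (leading_max FilP lq).
  apply: (fil_add FilP).
    by apply: (fil_anti FilP _ (leading_fil FilP lr)); rewrite ge_min lexx.
  by apply: (fil_anti FilP _ (leading_fil FilP ls)); rewrite ge_min lexx orbT.
- move=> c; have [->|/leadC/vE //] := eqVneq c 0.
  by rewrite !rmorph0.
- by exists t; apply: vE.
Qed.

Lemma valuation_eq (Fil : int -> L -> Prop) (v w : L -> int) :
    (forall g, g != 0 -> exists r, leading Fil r g) ->
    valuation v -> valuation w ->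
    (forall r g, leading Fil r g -> v g = r) ->
    (forall r g, leading Fil r g -> w g = r) ->
  v = w.
Proof.
move=> lead_ex v_val w_val vE wE; apply/funext => g.
have [->|/lead_ex[r lr]] := eqVneq g 0.
  by rewrite (val_zero v_val) (val_zero w_val).
by rewrite (vE _ _ lr) (wE _ _ lr).
Qed.

End Valuation.

(** * The point at infinity *)

Lemma bipoly_sum (R : comNzRingType) (p : {poly {poly R}}) :
  p = \sum_(j < size p) \sum_(i < size (p`_j)%R) (p`_j`_i *: 'X^i)%:P * 'X^j.
Proof.
rewrite -[LHS]coefK poly_def; apply: eq_bigr => j _.
rewrite -mulr_suml -mul_polyC; congr (_ * _).
by rewrite -rmorph_sum /= -poly_def coefK.
Qed.

Section PointAtInfinity.

Variables (K : fieldType) (n d : nat) (f : {poly K}).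
Hypotheses (d_gt0 : (0 < d)%N) (coprime_nd : coprime n d).
Hypothesis size_f : size f = n.+1.
Variables (L : fieldType) (beta : {rmorphism {poly {poly K}} -> L}).
Hypothesis ffL : function_field d f beta.

Local Notation x := (beta 'X%:P).
Local Notation y := (beta 'X).

Lemma ff_neq0 (q : {poly K}) : q != 0 -> beta q%:P != 0.
Proof. by move=> /(ff_unit ffL); rewrite unitfE. Qed.

Lemma ff_x_neq0 : x != 0.
Proof. by rewrite ff_neq0 ?polyX_eq0. Qed.

Lemma ff_y_neq0 : y != 0.
Proof.
have : y ^+ d != 0.
  by rewrite (ff_eqn ffL) ff_neq0 // -size_poly_eq0 size_f.
by rewrite expf_eq0 d_gt0.
Qed.

Variables (v : L -> int) (v_val : valuation beta v).

(** As x has a pole, q x dominates the constant added at each Horner step. *)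
Lemma val_poly_infty (q : {poly K}) : v x < 0 -> q != 0 ->
  v (beta q%:P) = (size q).-1%:Z * v x.
Proof.
move=> vx; elim/poly_ind: q => [|q c IH]; first by rewrite eqxx.
have [->|q0] := eqVneq q 0.
  rewrite mul0r add0r => _; rewrite (valC v_val) size_polyC.
  by case: (c != 0); rewrite mul0r.
move=> _; have := ff_neq0 q0 => bq0.
rewrite size_MXaddC (negPf q0) /= rmorphD rmorphM rmorphD rmorphM /=.
have vqx : v (beta q%:P * x) = (size q)%:Z * v x.
  rewrite (valM v_val) ?ff_x_neq0 // IH //.
  rewrite -[in RHS](prednK (_ : 0 < size q)%N) ?size_poly_gt0 //.
  by rewrite -addn1 PoszD mulrDl mul1r.
have qx0 : beta q%:P * x != 0 by rewrite mulf_neq0 ?ff_x_neq0.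
have [|_ ->] := val_dominant v_val qx0 (h := beta c%:P%:P); last by rewrite vqx.
right; rewrite (valC v_val) vqx.
have : (0 < size q)%N by rewrite size_poly_gt0.
by move=> sq; nia.
Qed.

(** From y^d = f one gets d v(y) = n v(x), and coprimality makes d divide v(x). The factor s is
    later shown to be 1 by [valuation_unique]. *)
Lemma val_infty_weights : v x < 0 ->
  exists2 s : int, 0 < s & v x = - (d%:Z * s) /\ v y = - (n%:Z * s).
Proof.
move=> vx; have eq_vy : d%:Z * v y = n%:Z * v x.
  rewrite -(valX v_val _ ff_y_neq0) (ff_eqn ffL) (val_poly_infty (q := f)) ?size_f //.
  by rewrite -size_poly_eq0 size_f.
have : (d%:Z %| v x)%Z.
  have : (d%:Z %| n%:Z * v x)%Z by rewrite -eq_vy dvdz_mulr.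
  by rewrite Gauss_dvdzr // coprimezE /= coprime_sym.
move=> /dvdzP[t vxE]; exists (- t); first by move: vx; rewrite vxE; nia.
split; first by rewrite vxE; ring.
have d0 : d%:Z != 0 by rewrite -lt0n.
by apply: (mulfI d0); rewrite eq_vy vxE; ring.
Qed.

Lemma val_infty_ge : v x < 0 ->
  exists2 s : int, 0 < s & forall r g, fil_infty n d beta r g ->
    val_ge v (s * r) g.
Proof.
move=> vx; have [s s0 [vxE vyE]] := val_infty_weights vx.
have wle_v p D : weight_le n d p D -> val_ge v (- (s * D)) (beta p).
  move=> pD; rewrite [p]bipoly_sum rmorph_sum; apply: (val_ge_sum v_val) => j _.
  rewrite rmorph_sum; apply: (val_ge_sum v_val) => i _.
  have [->|pij] := eqVneq p`_j`_i 0; first by rewrite scale0r mul0r rmorph0; left.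
  right; have q0 : p`_j`_i *: 'X^i != 0 :> {poly K}.
    by rewrite scaler_eq0 negb_or pij -size_poly_eq0 size_polyXn.
  rewrite rmorphM rmorphXn (valM v_val) ?expf_neq0 ?ff_y_neq0 ?ff_neq0 //.
  rewrite val_poly_infty // size_scale // size_polyXn (valX v_val) ?ff_y_neq0 //.
  rewrite vxE vyE /=; have := pD _ _ pij; rewrite PoszD !PoszM => leD.
  have -> : i%:Z * - (d%:Z * s) + j%:Z * - (n%:Z * s) =
            - (s * (d%:Z * i + n%:Z * j)) by ring.
  by rewrite lerN2 ler_pM2l.
exists s => // r g [q [p [q0 e /wle_v pD]]].
have bq0 := ff_neq0 q0; have -> : g = (beta q%:P)^-1 * beta p.
  by rewrite -e mulKf.
have -> : s * r = - v (beta q%:P) + - (s * ((d * (size q).-1)%N%:Z - r)).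
  by rewrite val_poly_infty // vxE PoszM; ring.
by apply: (val_geM v_val) => //; right; rewrite (valV v_val).
Qed.

Lemma val_infty_leading r g : v x < 0 -> leading (fil_infty n d beta) r g ->
  v g = r.
Proof.
move=> /val_infty_ge[s s0 sv]; have lead_ex := leading_infty_ex d_gt0 coprime_nd size_f ffL.
by have [_ vE] := valuation_unique lead_ex v_val s0 sv; apply: vE.
Qed.

Lemma val_infty_top (p : {poly {poly K}}) : v x < 0 -> (size p <= d)%N -> p != 0 ->
  exists i j, [/\ p`_j`_i != 0, weight_le n d p (d * i + n * j)%N
                & v (beta p) = - (d * i + n * j)%N%:Z].
Proof.
move=> vx sp p0; have [i [j [pij pD]]] := weight_top n d p0.
exists i, j; split=> //; rewrite (val_infty_leading vx (r := - (d * i + n * j)%N%:Z)) //.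
have := leading_infty d_gt0 coprime_nd size_f ffL (oner_neq0 _) sp (g := beta p).
move=> /(_ i j); rewrite rmorph1 mul1r size_poly1 muln0 sub0r; apply=> //.
Qed.

End PointAtInfinity.

Lemma val_infty_eq (K : fieldType) (n d : nat) (f : {poly K}) (L : fieldType)
    (beta : {rmorphism {poly {poly K}} -> L}) (v w : L -> int) :
    (0 < d)%N -> coprime n d -> size f = n.+1 -> function_field d f beta ->
    valuation beta v -> valuation beta w ->
    v (beta 'X%:P) < 0 -> w (beta 'X%:P) < 0 -> v = w.
Proof.
move=> d0 cnd sf ffL v_val w_val vx wx.
apply: (valuation_eq (leading_infty_ex d0 cnd sf ffL) v_val w_val) => r g.
  exact: (val_infty_leading d0 cnd sf ffL v_val vx).
exact: (val_infty_leading d0 cnd sf ffL w_val wx).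
Qed.

Lemma val_infty_exists (K : fieldType) (n d : nat) (f : {poly K}) (L : fieldType)
    (beta : {rmorphism {poly {poly K}} -> L}) :
    (0 < d)%N -> coprime n d -> size f = n.+1 -> function_field d f beta ->
  exists2 v, valuation beta v & v (beta 'X%:P) < 0.
Proof.
move=> d0 cnd sf ffL; have lead := leading_infty d0 cnd sf ffL.
have lead_ex := leading_infty_ex d0 cnd sf ffL.
have X0 k : 'X^k != 0 :> {poly K} by rewrite -size_poly_eq0 size_polyXn.
have [||v v_val vE] := @valuation_exists _ _ beta _ (fil_infty_filtration d0 cnd sf ffL) lead_ex.
- move=> c c0; have /(_ 0%N 0%N) := lead (beta c%:P%:P) 1 c%:P%:P.
  rewrite size_poly1 !muln0 subr0; apply.
  + exact: oner_neq0.
  + by rewrite (leq_trans (size_polyC_leq1 _)).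
  + by rewrite rmorph1 mul1r.
  + by rewrite !coefC.
  + by have := weight_leC n d (q := c%:P) (s := 0); rewrite muln0; apply; apply: size_polyC_leq1.
(* A local parameter at infinity: d k - n a = 1 gives y^a / x^k order 1, and a < d keeps its
   numerator reduced. *)
- have [a ltad /dvdnP[k]] := Bezoutl n d0.
  rewrite gcdnC (eqP cnd) => ek.
  exists (beta 'X^a / beta ('X^k)%:P).
  have /(_ 0%N a) := lead (beta 'X^a / beta ('X^k)%:P) 'X^k 'X^a.
  rewrite !size_polyXn /= muln0 add0n.
  have -> : (d * k)%N%:Z - (n * a)%N%:Z = 1 by lia.
  apply=> //.
  + by rewrite mulrC divfK // (ff_neq0 ffL).
  + by rewrite coefXn eqxx coef1 oner_neq0.
  + exact: weight_leXn.
exists v => //; have /(_ 1%N 0%N) := lead (beta 'X%:P) 1 'X%:P.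
rewrite size_poly1 !muln0 addn0 muln1 sub0r => /(_ _ _ _ _ _)/vE ->.
- by rewrite oppr_lt0.
- exact: oner_neq0.
- by rewrite (leq_trans (size_polyC_leq1 _)).
- by rewrite rmorph1 mul1r.
- by rewrite coefC coefX oner_neq0.
- by have := weight_leC n d (q := 'X) (s := 1); rewrite muln1; apply; rewrite size_polyX.
Qed.

(** * Affine points *)

Section Integral.

Variables (K L : fieldType) (beta : {rmorphism {poly {poly K}} -> L}).
Variables (v : L -> int) (v_val : valuation beta v).
Hypothesis x_ge0 : val_ge v 0 (beta 'X%:P).

Lemma val_ge0_poly (q : {poly K}) : val_ge v 0 (beta q%:P).
Proof.
elim/poly_ind: q => [|q c IH]; first by left; rewrite !rmorph0.
rewrite polyCD polyCM rmorphD rmorphM; apply: (val_geD v_val).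
  by rewrite -[0]addr0; apply: (val_geM v_val).
exact: (val_geC v_val).
Qed.

Lemma val_ge0_poly2 (p : {poly {poly K}}) :
  val_ge v 0 (beta 'X) -> val_ge v 0 (beta p).
Proof.
move=> y_ge0; elim/poly_ind: p => [|p q IH]; first by left; rewrite rmorph0.
rewrite rmorphD rmorphM; apply: (val_geD v_val); last exact: val_ge0_poly.
by rewrite -[0]addr0; apply: (val_geM v_val).
Qed.

End Integral.

Section AffinePoint.

Variables (K : fieldType) (d : nat) (f : {poly K}).
Variables (L : fieldType) (beta : {rmorphism {poly {poly K}} -> L}).
Hypothesis ffL : function_field d f beta.
Variables (a b : K) (curve_ab : b ^+ d = f.[a]).

Definition eval2 (x0 y0 : K) (p : {poly {poly K}}) : K := p.[y0%:P].[x0].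

Local Notation ev := (eval2 a b).
Local Notation xa := (('X - a%:P)%:P : {poly {poly K}}).
Local Notation yb := ('X - b%:P%:P : {poly {poly K}}).

Lemma eval2M x0 y0 p q : eval2 x0 y0 (p * q) = eval2 x0 y0 p * eval2 x0 y0 q.
Proof. by rewrite /eval2 !hornerM. Qed.

Lemma eval2X x0 y0 p k : eval2 x0 y0 (p ^+ k) = eval2 x0 y0 p ^+ k.
Proof. by rewrite /eval2 !horner_exp. Qed.

Lemma eval2B x0 y0 p q : eval2 x0 y0 (p - q) = eval2 x0 y0 p - eval2 x0 y0 q.
Proof. by rewrite /eval2 !hornerE. Qed.

Lemma eval2D x0 y0 p q : eval2 x0 y0 (p + q) = eval2 x0 y0 p + eval2 x0 y0 q.
Proof. by rewrite /eval2 !hornerE. Qed.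

Lemma eval2C x0 y0 (q : {poly K}) : eval2 x0 y0 q%:P = q.[x0].
Proof. by rewrite /eval2 hornerC. Qed.

Lemma eval2_ff (p q : {poly {poly K}}) : beta p = beta q -> ev p = ev q.
Proof.
move=> e; have /(ff_ker ffL)[u pq] : beta (p - q) = 0 by rewrite rmorphB e subrr.
apply/eqP; rewrite -subr_eq0 -eval2B pq eval2M /eval2 !hornerE curve_ab.
by rewrite subrr mul0r.
Qed.

Lemma eval2_neq0 p : ev p != 0 -> beta p != 0.
Proof.
apply: contraNneq; rewrite -(rmorph0 beta) => /eval2_ff ->.
by rewrite /eval2 !horner0.
Qed.

Lemma eval2_eq0 p : ev p = 0 -> exists p1 p2, p = xa * p1 + yb * p2.
Proof.
move=> evp; have /factor_theorem[p2 p2E] : root (p - p.[b%:P]%:P) b%:P.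
  by rewrite /root !hornerE subrr.
have /factor_theorem[p1 p1E] : root p.[b%:P] a by rewrite /root -/(eval2 a b p) evp.
exists p1%:P, p2; rewrite -polyCM [_ * p1]mulrC -p1E [_ * p2]mulrC -p2E.
by rewrite addrC subrK.
Qed.

(* [T] generates the maximal ideal of the local ring at [(a, b)]. *)
Record uniformizer (T : {poly {poly K}}) : Prop := Uniformizer {
  unif_ev : ev T = 0;
  unif_neq0 : beta T != 0;
  unif_x : exists U W, ev U != 0 /\ beta U * beta xa = beta T * beta W;
  unif_y : exists U W, ev U != 0 /\ beta U * beta yb = beta T * beta W;
  unif_exp : exists (e : nat) U W,
    [/\ ev U != 0, ev W != 0 & beta U * beta xa = beta T ^+ e * beta W] }.

Variables (T : {poly {poly K}}) (unifT : uniformizer T).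

(** This is T^r times the local ring at (a, b), with V a denominator that does not vanish there. *)
Definition fil_affine (r : int) (g : L) : Prop :=
  exists V W, ev V != 0 /\ beta V * g = beta T ^ r * beta W.

Let T0 := unif_neq0 unifT.

Lemma fil_affine_filtration : filtration fil_affine.
Proof.
split.
- move=> r; exists 1, 0; rewrite /eval2 !hornerE oner_neq0; split=> //.
  by rewrite rmorph0 !mulr0.
- move=> r s g lers [V [W [V0 e]]]; have [k sE] : exists k : nat, s = r + k%:Z.
    by exists `|s - r|%N; lia.
  exists V, (T ^+ k * W); split=> //; rewrite e sE expfzDr //.
  by rewrite rmorphM rmorphXn mulrA.
- move=> r g h [V [W [V0 e]]] [V' [W' [V'0 e']]].
  exists (V * V'), (W * V' - W' * V); rewrite eval2M mulf_neq0 //; split=> //.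
  rewrite rmorphB !rmorphM.
  have -> : beta V * beta V' * (g - h) = beta V * g * beta V' - beta V' * h * beta V.
    by ring.
  by rewrite e e'; ring.
- move=> r s g h [V [W [V0 e]]] [V' [W' [V'0 e']]].
  exists (V * V'), (W * W'); rewrite eval2M mulf_neq0 //; split=> //.
  by rewrite !rmorphM mulrACA e e' mulrACA expfzDr.
- case=> V [W [V0]]; rewrite mulr1 expr1z -rmorphM => /eval2_ff.
  by rewrite eval2M (unif_ev unifT) mul0r => V00; rewrite V00 eqxx in V0.
Qed.

Lemma leading_affine (r : int) (g : L) (V W : {poly {poly K}}) :
  ev V != 0 -> ev W != 0 -> beta V * g = beta T ^ r * beta W ->
  leading fil_affine r g.
Proof.
move=> V0 W0 e; have bV := eval2_neq0 V0; have bW := eval2_neq0 W0.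
have g0 : g != 0.
  apply: contraNneq (mulf_neq0 (expfz_neq0 r T0) bW) => g0.
  by rewrite -e g0 mulr0.
exists g, g^-1; split.
- by rewrite divff.
- by exists V, W.
- exists W, V; split=> //; rewrite -invr_expz.
  have -> : beta V = beta T ^ r * beta W / g by rewrite -e mulfK.
  by rewrite !mulrA mulVf ?mul1r // expfz_neq0.
- by rewrite subrr; apply: fil_zero fil_affine_filtration _.
Qed.

Lemma uniformizer_dvd p : ev p = 0 ->
  exists U W, ev U != 0 /\ beta U * beta p = beta T * beta W.
Proof.
move=> /eval2_eq0[p1 [p2 ->]].
have [U1 [W1 [U10 e1]]] := unif_x unifT.
have [U2 [W2 [U20 e2]]] := unif_y unifT.
exists (U1 * U2), (W1 * p1 * U2 + W2 * p2 * U1); split.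
  by rewrite eval2M mulf_neq0.
rewrite [beta (U1 * U2)]rmorphM [beta (xa * p1 + _)]rmorphD.
rewrite [beta (_ + _ * U1)]rmorphD !rmorphM.
have -> : beta U1 * beta U2 * (beta xa * beta p1 + beta yb * beta p2) =
  beta U1 * beta xa * (beta p1 * beta U2) + beta U2 * beta yb * (beta p2 * beta U1).
  by ring.
by rewrite e1 e2; ring.
Qed.

(** The largest power of T dividing p locally leaves a cofactor that does not vanish at the point.
    Such powers are bounded: p divides some nonzero q(x), which is (x - a)^k times a local unit, and
    by [unif_exp] x - a is T^e times a local unit, so that r is at most e k. *)
Lemma leading_affine_poly p : beta p != 0 ->
  exists (r : nat) V W,
    [/\ ev V != 0, ev W != 0 & beta V * beta p = beta T ^+ r * beta W].
Proof.
move=> p0; have [q [p' [q0 _ pp']]] := ff_frac ffL (beta p)^-1.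
have {}pp' : beta q%:P = beta p * beta p' by rewrite -pp' mulrC divfK.
have [k [c [c0 qE]]] : exists k (c : {poly K}), c.[a] != 0 /\ q = ('X - a%:P) ^+ k * c.
  by have [k [c rc ->]] := multiplicity_XsubC q a; exists k, c; rewrite q0 /= in rc; rewrite mulrC.
have [e [U [W [U0 W0 eqU]]]] := unif_exp unifT.
have bound (r : nat) V W' : ev V != 0 -> beta V * beta p = beta T ^+ r * beta W' ->
    (r <= e * k)%N.
  move=> V0 eqV; rewrite leqNgt; apply/negP => lt_ek.
  have e1 : beta V * beta T ^+ (e * k) * beta W ^+ k * beta c%:P
          = beta T ^+ r * (beta W' * beta p' * beta U ^+ k).
    have eqk : beta U ^+ k * beta xa ^+ k = beta T ^+ (e * k) * beta W ^+ k.
      by rewrite -exprMn eqU exprMn exprM.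
    have eqq : beta xa ^+ k * beta c%:P = beta p * beta p'.
      by rewrite -pp' qE polyCM polyC_exp rmorphM rmorphXn.
    have -> : beta T ^+ r * (beta W' * beta p' * beta U ^+ k)
            = (beta T ^+ r * beta W') * (beta p' * beta U ^+ k) by ring.
    rewrite -eqV; have -> : beta V * beta p * (beta p' * beta U ^+ k)
            = beta V * beta U ^+ k * (beta p * beta p') by ring.
    rewrite -eqq; have -> : beta V * beta U ^+ k * (beta xa ^+ k * beta c%:P)
            = beta V * (beta U ^+ k * beta xa ^+ k) * beta c%:P by ring.
    by rewrite eqk !mulrA.
  have [s rE] : exists s, r = (e * k + s.+1)%N by exists (r - e * k).-1; lia.
  have : beta (V * W ^+ k * c%:P) = beta (T * (T ^+ s * (W' * p' * U ^+ k))).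
    apply: (mulfI (expf_neq0 (e * k) T0)).
    rewrite !rmorphM !rmorphXn; move: e1; rewrite rE exprD exprS => e1.
    by rewrite -!mulrA !mulrA; move: e1; rewrite !mulrA => <-; ring.
  move/eval2_ff; rewrite !eval2M eval2X (unif_ev unifT) mul0r eval2C => /eqP.
  by rewrite !mulf_eq0 expf_eq0 (negPf V0) (negPf W0) (negPf c0) andbF.
have ex0 : exists r : nat, `[< exists V W', ev V != 0 /\
    beta V * beta p = beta T ^+ r * beta W' >].
  exists 0%N; apply/asboolP; exists 1, p; rewrite expr0 rmorph1 /eval2 !hornerE.
  by rewrite oner_neq0.
have ub r : `[< exists V W', ev V != 0 /\
    beta V * beta p = beta T ^+ r * beta W' >] -> (r <= e * k)%N.
  by move=> /asboolP[V [W' [V0 eqV]]]; apply: bound eqV.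
case: (ex_maxnP ex0 ub) => r /asboolP[V [W' [V0 eqV]]] maxr.
(* If the cofactor vanished at the point, one more factor T could be extracted, against the
   maximality of r. *)
exists r, V, W'; split=> //; apply/eqP => /uniformizer_dvd[U' [W'' [U'0 eqU']]].
have /maxr : `[< exists V W', ev V != 0 /\
    beta V * beta p = beta T ^+ r.+1 * beta W' >].
  apply/asboolP; exists (V * U'), W''; rewrite eval2M mulf_neq0 //; split=> //.
  by rewrite rmorphM mulrAC eqV -mulrA [beta W' * _]mulrC eqU' exprSr mulrA.
by rewrite ltnn.
Qed.

Lemma leading_affine_ex (g : L) : g != 0 -> exists r, leading fil_affine r g.
Proof.
move=> g0; have [q [p [q0 _ e]]] := ff_frac ffL g.
have bq0 := ff_neq0 ffL q0.
have p0 : beta p != 0 by rewrite -e mulf_neq0.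
have [r [V [W [V0 W0 eV]]]] := leading_affine_poly p0.
have [s [V' [W' [V'0 W'0 eV']]]] := leading_affine_poly bq0.
exists (r%:Z - s%:Z).
apply: (@leading_affine _ _ (V * W') (W * V')); rewrite ?eval2M ?mulf_neq0 //.
rewrite expfzDr // -exprnN -exprnP !rmorphM.
apply: (mulfI (expf_neq0 s T0)); apply: (mulfI bq0).
have -> : beta q%:P * (beta T ^+ s * (beta V * beta W' * g)) =
   (beta V * (beta q%:P * g)) * (beta T ^+ s * beta W') by ring.
rewrite e eV -eV'; field; exact: expf_neq0.
Qed.

Lemma affine_valuation_exists : beta yb != 0 ->
  exists2 v, valuation beta v & 0 < v (beta xa) /\ 0 < v (beta yb).
Proof.
move=> yb_neq0; have ev1 : ev 1 != 0 by rewrite /eval2 !hornerE oner_neq0.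
have C0 (c : K) : c != 0 -> leading fil_affine 0 (beta c%:P%:P).
  move=> c0; apply: (@leading_affine _ _ 1 c%:P%:P) => //.
    by rewrite eval2C hornerC.
  by rewrite rmorph1 expr0z.
have T1 : leading fil_affine 1 (beta T).
  by apply: (@leading_affine _ _ 1 1) => //; rewrite rmorph1 mulr1 mul1r.
have exT : exists t, leading fil_affine 1 t by exists (beta T).
have [v v_val vE] := valuation_exists fil_affine_filtration leading_affine_ex C0 exT.
exists v => //.
have vpos p : beta p != 0 ->
    (exists U W, ev U != 0 /\ beta U * beta p = beta T * beta W) -> 0 < v (beta p).
  move=> p0 [U [W [U0 eU]]]; have [r lr] := leading_affine_ex p0.
  rewrite (vE _ _ lr) -lezD1 add0r.
  by apply: (leading_max fil_affine_filtration lr); exists U, W; rewrite expr1z.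
split; apply: vpos.
- by rewrite (ff_neq0 ffL) // polyXsubC_eq0.
- exact: unif_x unifT.
- exact: yb_neq0.
- exact: unif_y unifT.
Qed.

Section Value.

Variables (v : L -> int) (v_val : valuation beta v).
Hypotheses (vx : 0 < v (beta xa)) (vy : 0 < v (beta yb)).

Lemma val_ge0_ff p : val_ge v 0 (beta p).
Proof.
apply: (val_ge0_poly2 v_val).
- rewrite -['X](subrK a%:P) polyCD rmorphD.
  by apply: (val_geD v_val); [right; apply: ltW | apply: (val_geC v_val)].
- rewrite -['X](subrK b%:P%:P) rmorphD.
  by apply: (val_geD v_val); [right; apply: ltW | apply: (val_geC v_val)].
Qed.

Lemma val_ge1_ff p : ev p = 0 -> val_ge v 1 (beta p).
Proof.
move=> /eval2_eq0[p1 [p2 ->]]; rewrite rmorphD !rmorphM -[1]addr0.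
apply: (val_geD v_val); apply: (val_geM v_val); try exact: val_ge0_ff.
- by right; rewrite -[1]add0r lezD1.
- by right; rewrite -[1]add0r lezD1.
Qed.

Lemma val_eq0_ff p : ev p != 0 -> v (beta p) = 0.
Proof.
move=> p0; set c := (ev p)%:P%:P.
have vc : v (beta c) = 0 by apply: (valC v_val).
have c0 : beta c != 0 by rewrite (ff_neq0 ffL) // polyC_eq0.
have [|_] := val_dominant v_val c0 (h := beta (p - c)).
  rewrite vc add0r; apply: val_ge1_ff.
  by rewrite eval2B eval2C hornerC subrr.
by rewrite -rmorphD addrC subrK vc.
Qed.

Lemma val_gt0_ff p : beta p != 0 -> (0 < v (beta p)) = (ev p == 0).
Proof.
move=> p0; have [/val_ge1_ff/(val_geE p0)|/val_eq0_ff ->] := eqVneq (ev p) 0.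
  by rewrite -lezD1.
by rewrite ltxx.
Qed.

(** The scale in [valuation_unique] is v(T) itself, so that its being 1 is a conclusion and not an
    assumption. *)
Lemma val_affine_leading : v (beta T) = 1 /\
  forall r g, leading fil_affine r g -> v g = r.
Proof.
have T_pos : 0 < v (beta T) by rewrite val_gt0_ff // (unif_ev unifT).
apply: (valuation_unique leading_affine_ex v_val T_pos) => r g [V [W [V0 e]]].
have bV0 := eval2_neq0 V0.
have -> : g = (beta V)^-1 * (beta T ^ r * beta W) by rewrite -e mulKf.
rewrite -[_ * r]add0r; apply: (val_geM v_val).
  by right; rewrite (valV v_val) // val_eq0_ff.
rewrite -[_ * r]addr0; apply: (val_geM v_val) (val_ge0_ff W).
by right; rewrite (valXz v_val) // mulrC.
Qed.

End Value.

Lemma val_affine_eq (v w : L -> int) : valuation beta v -> valuation beta w ->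
  0 < v (beta xa) -> 0 < v (beta yb) -> 0 < w (beta xa) -> 0 < w (beta yb) -> v = w.
Proof.
move=> v_val w_val vx vy wx wy.
apply: (valuation_eq leading_affine_ex v_val w_val).
  by case: (val_affine_leading v_val vx vy).
by case: (val_affine_leading w_val wx wy).
Qed.

End AffinePoint.

Section Points.

Variables (K : closedFieldType) (n d : nat) (f : {poly K}).
Hypotheses (d_gt1 : (1 < d)%N) (coprime_nd : coprime n d).
Hypothesis size_f : size f = n.+1.
Hypotheses (d_neq0 : d%:R != 0 :> K) (f_simple : no_repeated_roots f).
Variables (L : fieldType) (beta : {rmorphism {poly {poly K}} -> L}).
Hypothesis ffL : function_field d f beta.

Let d_gt0 : (0 < d)%N := ltnW d_gt1.
Let f_neq0 : f != 0 := size_poly_neq0 size_f.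

Lemma ff_yb_neq0 (b : K) : beta ('X - b%:P%:P) != 0.
Proof.
apply/eqP => /(ff_small_eq0 d_gt0 ffL); rewrite size_XsubC => /(_ d_gt1) /eqP.
by rewrite polyXsubC_eq0.
Qed.

(** The cofactor of y - b in y^d - b^d takes the value d b^(d - 1) at the point, which is nonzero in
    K; as x - a divides f - f(a) = y^d - b^d, it divides y - b locally. *)
Lemma unif_unramified (a b : K) : b ^+ d = f.[a] -> b != 0 ->
  uniformizer beta a b ('X - a%:P)%:P.
Proof.
move=> ab b0; split.
- by rewrite eval2C !hornerE subrr.
- by rewrite (ff_neq0 ffL) // polyXsubC_eq0.
- by exists 1, 1; rewrite eval2C hornerC oner_neq0 rmorph1 mul1r mulr1.
- have /factor_theorem[h hE] : root (f - f.[a]%:P) a.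
    by rewrite /root !hornerE subrr.
  exists (\sum_(i < d) 'X^(d.-1 - i) * b%:P%:P ^+ i), h%:P; split.
    rewrite /eval2 !horner_sum (eq_bigr (fun=> b ^+ d.-1)) => [|i _].
      by rewrite sumr_const card_ord -mulr_natr mulf_neq0 ?expf_neq0.
    rewrite !hornerE -exprD subnK // -ltnS prednK //.
  rewrite -rmorphM mulrC -subrXX -rmorphM -polyCM [_ * h]mulrC -hE.
  by rewrite !rmorphB rmorphXn (ff_eqn ffL) -!polyC_exp ab.
- by exists 1%N, 1, 1; rewrite eval2C hornerC oner_neq0 rmorph1 mul1r mulr1.
Qed.

(** As a is a simple root, y^d = h(x) (x - a) with h(a) nonzero, so x - a is y^d up to a local
    unit. *)
Lemma unif_ramified (a : K) : root f a -> uniformizer beta a 0 'X.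
Proof.
move=> ra; have y0 := ff_y_neq0 d_gt0 size_f ffL.
have [h fE] := factor_theorem _ _ ra.
have ha : h.[a] != 0.
  apply: contraL (f_simple a) => ha; rewrite -ltnNge mup_geq //.
  by rewrite fE expr2 dvdp_mul2r ?polyXsubC_eq0 // dvdp_XsubCl.
have eqh : beta h%:P * beta ('X - a%:P)%:P = beta 'X ^+ d.
  by rewrite -rmorphM -polyCM -fE (ff_eqn ffL).
split=> //.
- by rewrite /eval2 !hornerE.
- exists h%:P, 'X^(d.-1); rewrite eval2C; split=> //.
  by rewrite eqh rmorphXn -exprS prednK.
- exists 1, 1; rewrite eval2C hornerC oner_neq0 rmorph1 mul1r mulr1.
  by rewrite subr0.
- by exists d, h%:P, 1; rewrite !eval2C hornerC oner_neq0 rmorph1 mulr1.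
Qed.

Lemma unif_exists (a b : K) : b ^+ d = f.[a] ->
  exists2 T, uniformizer beta a b T & T = if b == 0 then 'X else ('X - a%:P)%:P.
Proof.
move=> ab; eexists; last reflexivity.
have [b0|b0] := eqVneq b 0; last exact: unif_unramified.
rewrite b0; apply: unif_ramified; rewrite /root -ab b0 expr0n.
by case: (d) d_gt0.
Qed.

Definition val_at (v : L -> int) (a b : K) : Prop :=
  [/\ valuation beta v, b ^+ d = f.[a], 0 < v (beta ('X - a%:P)%:P)
    & 0 < v (beta ('X - b%:P%:P))].

Lemma val_at_exists (a b : K) : b ^+ d = f.[a] -> exists v, val_at v a b.
Proof.
move=> ab; have [T unifT _] := unif_exists ab.
have [v v_val [vx vy]] := affine_valuation_exists ffL ab unifT (ff_yb_neq0 b).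
by exists v.
Qed.

Lemma val_at_eq v w (a b : K) : val_at v a b -> val_at w a b -> v = w.
Proof.
move=> [v_val ab vx vy] [w_val _ wx wy]; have [T unifT _] := unif_exists ab.
exact: (val_affine_eq ffL ab unifT v_val w_val vx vy wx wy).
Qed.

Lemma val_at_gt0 v (a b : K) p : val_at v a b -> beta p != 0 ->
  (0 < v (beta p)) = (eval2 a b p == 0).
Proof. move=> [v_val ab vx vy]; exact: (val_gt0_ff ffL v_val vx vy). Qed.

Lemma val_at_ge0 v (a b : K) p : val_at v a b -> val_ge v 0 (beta p).
Proof. move=> [v_val ab vx vy]; exact: (val_ge0_ff v_val vx vy). Qed.

Lemma val_at_unif v (a b : K) : val_at v a b ->
  v (beta (if b == 0 then 'X else ('X - a%:P)%:P)) = 1.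
Proof.
move=> [v_val ab vx vy]; have [T unifT <-] := unif_exists ab.
by have [] := val_affine_leading ffL ab unifT v_val vx vy.
Qed.

Lemma val_at_x_ge0 v (a b : K) : val_at v a b -> ~~ (v (beta 'X%:P) < 0).
Proof.
move=> /(val_at_ge0 'X%:P)/(val_geE (ff_x_neq0 ffL)).
by rewrite -leNgt.
Qed.

(** Over an algebraically closed field q splits, and a nonzero order must come from one of its
    linear factors. The embedding is a parameter because both K[x] and K[y] are needed. *)
Lemma val_root (v : L -> int) (iota : {rmorphism {poly K} -> L}) (q : {poly K}) :
    valuation beta v -> (forall c, v (iota c%:P) = 0) ->
    (forall z, iota ('X - z%:P) != 0) -> (forall z, 0 <= v (iota ('X - z%:P))) ->
    q != 0 -> v (iota q) != 0 ->
  exists2 z, root q z & 0 < v (iota ('X - z%:P)).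
Proof.
move=> v_val iotaC iotaX v_ge0 q0; apply: contraNP => none.
have [r qE] := closed_field_poly_normal q.
have lq0 : iota (lead_coef q)%:P != 0.
  apply: contraNneq (oner_neq0 L) => e; rewrite -(rmorph1 iota) -polyC1.
  by rewrite -(mulfV (_ : lead_coef q != 0)) ?lead_coef_eq0 // polyCM rmorphM e mul0r.
rewrite {1}qE -mul_polyC rmorphM.
have vr (s : seq K) : {subset s <= r} ->
   iota (\prod_(z <- s) ('X - z%:P)) != 0 /\ v (iota (\prod_(z <- s) ('X - z%:P))) = 0.
  elim: s => [|z s IH] sr.
    by rewrite big_nil rmorph1 oner_neq0 (val_one v_val).
  have [|s0 vs0] := IH; first by move=> t ts; apply: sr; rewrite inE ts orbT.
  rewrite big_cons rmorphM mulf_neq0 //; split=> //.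
  rewrite (valM v_val) // vs0 addr0; apply/le_anti; rewrite v_ge0 andbT leNgt.
  apply/negP => vz; apply: none; exists z => //.
  rewrite qE rootZ ?lead_coef_eq0 // root_prod_XsubC sr // inE eqxx //.
have [//|r0 vr0] := vr r.
by rewrite (valM v_val) // vr0 iotaC.
Qed.

(** If x has no pole, some x - a has positive order; then so has y^d - f(a) = f(x) - f(a), and hence
    some factor y - b with b^d = f(a). *)
Lemma val_classify (v : L -> int) : valuation beta v ->
  v (beta 'X%:P) < 0 \/ exists a b, val_at v a b.
Proof.
move=> v_val; have [vx|vx] := ltP (v (beta 'X%:P)) 0; [by left | right].
have xge0 : val_ge v 0 (beta 'X%:P) by right.
have y0 := ff_y_neq0 d_gt0 size_f ffL.
pose iota : {rmorphism {poly K} -> L} := beta \o polyC.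
(* Otherwise v is trivial on K[x], hence zero on y by y^d = f and nonnegative on K[x, y]; but a
   function of order -1 has a numerator in K[x, y] over a denominator in K[x]. *)
have [q q0 vq] : exists2 q, q != 0 & v (iota q) != 0.
  apply: contrapT => none.
  have v0 (q : {poly K}) : q != 0 -> v (beta q%:P) = 0.
    by move=> q0; apply/eqP; apply: contrapT => /negP vq; apply: none; exists q.
  have vy : v (beta 'X) = 0.
    have := valX v_val d y0; rewrite (ff_eqn ffL) v0 // => /esym/eqP.
    by rewrite mulf_eq0 => /orP[/eqP d0|/eqP //]; move: d_gt0; rewrite (_ : d = 0%N) //; lia.
  have yge0 : val_ge v 0 (beta 'X) by right; rewrite vy.
  have [t vt] := val_onto v_val.
  have t0 : t != 0 by apply/eqP => t0; move: vt; rewrite t0 (val_zero v_val).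
  have [q [p [q0 _ e]]] := ff_frac ffL t^-1.
  have : v (beta p) = -1.
    rewrite -e (valM v_val) ?invr_eq0 ?(ff_neq0 ffL) // v0 // (valV v_val) //.
    by rewrite vt add0r.
  have [p0|] := val_ge0_poly2 v_val xge0 p yge0; last by move=> + e1; rewrite e1.
  by rewrite p0 (val_zero v_val).
have [|||a _ vxa] := val_root v_val _ _ _ q0 vq.
- by move=> c; apply: (valC v_val).
- by move=> z; rewrite (ff_neq0 ffL) // polyXsubC_eq0.
- move=> z; apply: val_geE; first by rewrite (ff_neq0 ffL) // polyXsubC_eq0.
  rewrite rmorphB /=; apply: (val_geB v_val) => //.
  exact: (val_geC v_val).
exists a.
pose iota2 : {rmorphism {poly K} -> L} := beta \o map_poly polyC.
have iotaX z : iota2 ('X - z%:P) = beta ('X - z%:P%:P).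
  by rewrite /iota2 /= map_polyXsubC.
have n_gt0 : (0 < n)%N.
  by rewrite lt0n; apply: contraTneq coprime_nd => ->; rewrite /coprime gcd0n gtn_eqF.
have fa0 : f - f.[a]%:P != 0.
  apply: contraTneq n_gt0 => /eqP; rewrite subr_eq0 => /eqP fE.
  by have := size_polyC_leq1 f.[a]; rewrite -fE size_f ltnS leqn0 => /eqP->.
have yge0 : val_ge v 0 (beta 'X).
  right; have := valX v_val d y0; rewrite (ff_eqn ffL) => vf.
  have := val_geE (ff_neq0 ffL f_neq0) (val_ge0_poly v_val xge0 f).
  by rewrite vf pmulr_rge0 // ltz_nat.
have vf : 0 < v (beta (f - f.[a]%:P)%:P).
  have /factor_theorem[h hE] : root (f - f.[a]%:P) a.
    by rewrite /root !hornerE subrr.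
  suff : val_ge v 1 (beta (f - f.[a]%:P)%:P) by move/(val_geE (ff_neq0 ffL fa0)).
  rewrite hE polyCM rmorphM -[1]add0r; apply: (val_geM v_val).
    exact: val_ge0_poly.
  by right; rewrite -lezD1 in vxa.
have q2E : iota2 ('X^d - f.[a]%:P) = beta (f - f.[a]%:P)%:P.
  rewrite /iota2 /= rmorphB /= map_polyXn map_polyC !rmorphB rmorphXn.
  by rewrite (ff_eqn ffL).
have [|||||b] := val_root v_val (iota := iota2) (q := 'X^d - f.[a]%:P).
- by move=> c; rewrite /iota2 /= map_polyC; apply: (valC v_val).
- by move=> z; rewrite iotaX ff_yb_neq0.
- move=> z; rewrite iotaX; apply: val_geE; first exact: ff_yb_neq0.
  by rewrite rmorphB; apply: (val_geB v_val) => //; apply: (val_geC v_val).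
- by rewrite -size_poly_eq0 size_XnsubC.
- by rewrite q2E gt_eqF.
rewrite /root !hornerE subr_eq0 iotaX => /eqP ab vyb.
by exists b.
Qed.

End Points.

(** * Functions regular on the affine curve *)

Section Regular.

Variables (K : closedFieldType) (n d : nat) (f : {poly K}).
Hypothesis d_gt1 : (1 < d)%N.
Hypothesis size_f : size f = n.+1.
Hypotheses (d_neq0 : d%:R != 0 :> K) (f_simple : no_repeated_roots f).
Variables (L : fieldType) (beta : {rmorphism {poly {poly K}} -> L}).
Hypothesis ffL : function_field d f beta.

Let d_gt0 : (0 < d)%N := ltnW d_gt1.
Let f_neq0 : f != 0 := size_poly_neq0 size_f.

(** X^d - c is separable because d and c are nonzero in K, so P would have d distinct roots and
    degree less than d. *)
Lemma eq0_on_roots (c : K) (P : {poly K}) : c != 0 -> (size P <= d)%N ->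
  (forall z, z ^+ d = c -> P.[z] = 0) -> P = 0.
Proof.
move=> c0 sP Pz; have [r] := closed_field_poly_normal ('X^d - c%:P).
rewrite (monicP (monicXnsubC _ d_gt0)) scale1r => rE.
have ur : uniq r.
  rewrite -separable_prod_XsubC -rE separable_poly.unlock derivB derivC subr0 derivXn.
  rewrite -scaler_nat coprimepZr // coprimep_expr // coprimepX /root !hornerE.
  by rewrite expr0n gtn_eqF // sub0r oppr_eq0.
have sr : size r = d.
  have : size (\prod_(z <- r) ('X - z%:P)) = d.+1 by rewrite -rE size_XnsubC.
  by rewrite size_prod_XsubC => -[].
apply: contraTeq sP => P0; rewrite -ltnNge -sr; apply: max_poly_roots => //.
apply/allP => z zr; apply/eqP/Pz/eqP.
have : root ('X^d - c%:P) z by rewrite rE root_prod_XsubC.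
by rewrite /root !hornerE subr_eq0.
Qed.

Lemma val_at_ramified_x v (a : K) : val_at d f beta v a 0 ->
  v (beta ('X - a%:P)%:P) = d.
Proof.
move=> va; have [v_val fa vx vy] := va.
have vY : v (beta 'X) = 1.
  by have := val_at_unif d_gt1 size_f d_neq0 f_simple ffL va; rewrite eqxx.
have y0 := ff_y_neq0 d_gt0 size_f ffL.
have xa0 : beta ('X - a%:P)%:P != 0 by rewrite (ff_neq0 ffL) // polyXsubC_eq0.
have ra : root f a by rewrite /root -fa expr0n gtn_eqF.
have [h fE] := factor_theorem _ _ ra.
have ha : h.[a] != 0.
  apply: contraL (f_simple a) => ha; rewrite -ltnNge mup_geq //.
  by rewrite fE expr2 dvdp_mul2r ?polyXsubC_eq0 // dvdp_XsubCl.
have h0 : beta h%:P != 0 by rewrite (ff_neq0 ffL) //; apply: contraNneq ha => ->; rewrite horner0.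
have := valX v_val d y0; rewrite vY mulr1 (ff_eqn ffL) fE polyCM rmorphM.
rewrite (valM v_val) //.
have -> : v (beta h%:P) = 0; last by rewrite add0r.
apply/eqP; have := val_at_ge0 h%:P va => /(val_geE h0).
rewrite le_eqVlt (val_at_gt0 ffL va h0) eval2C => /orP[/eqP <- //|].
by rewrite (negPf ha).
Qed.

(* Since [x - a] has order [d] and [y] has order one, the terms [c_j(x) y^j] with
   [j < d] and [c_j(a) <> 0] have distinct orders [j]. *)
Lemma ramified_coef_eq0 v (a : K) p j : val_at d f beta v a 0 ->
  val_ge v d (beta p) -> (j < d)%N -> (p`_j).[a] = 0.
Proof.
move=> va vp; elim/ltn_ind: j => j IH ltjd; apply/eqP; apply: contraT => pj.
have [v_val fa vx vy] := va; rewrite subr0 in vy.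
have vY : v (beta 'X) = 1.
  by have := val_at_unif d_gt1 size_f d_neq0 f_simple ffL va; rewrite eqxx.
have y0 := ff_y_neq0 d_gt0 size_f ffL.
have vX := val_at_ramified_x va.
have vtake : val_ge v d (beta (take_poly j p)).
  rewrite /take_poly poly_def rmorph_sum; apply: (val_ge_sum v_val) => i _.
  have /factor_theorem[h ->] : root p`_i a.
    by apply/eqP; apply: IH => //; apply: ltn_trans ltjd.
  rewrite -mul_polyC rmorphM polyCM rmorphM mulrAC -[d%:Z]add0r.
  apply: (val_geM v_val); last by right; rewrite vX.
  by rewrite -rmorphM; apply: val_at_ge0 va.
have : val_ge v d (beta (drop_poly j p * 'X^j)).
  have -> : drop_poly j p * 'X^j = p - take_poly j p.
    by apply/eqP; rewrite eq_sym subr_eq addrC poly_take_drop.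
  by rewrite rmorphB; apply: (val_geB v_val).
have evdrop : eval2 a 0 (drop_poly j p) != 0.
  by rewrite /eval2 horner_coef0 coef_drop_poly add0n.
have drop0 := eval2_neq0 ffL fa evdrop.
rewrite rmorphM => /(val_geE (mulf_neq0 drop0 _)); rewrite rmorphXn expf_neq0 //.
move=> /(_ isT); rewrite (valM v_val) ?expf_neq0 // (valX v_val) // vY mulr1.
have [_ _ vx' vy'] := va.
by rewrite (val_eq0_ff ffL v_val vx' vy' evdrop) add0r lez_nat leqNgt ltjd.
Qed.

(** Specializing x to a leaves a polynomial in y of degree less than d that vanishes at the d
    distinct points above a. *)
Lemma unramified_coef_eq0 (a : K) (p : {poly {poly K}}) j : f.[a] != 0 -> (size p <= d)%N ->
  (forall b, b ^+ d = f.[a] -> eval2 a b p = 0) -> (p`_j).[a] = 0.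
Proof.
move=> fa sp pb; pose P := map_poly (horner_eval a) p.
suff P0 : P = 0 by have := coef_map (horner_eval a) p j; rewrite -/P P0 coef0 /= horner_evalE.
apply: (eq0_on_roots fa).
  by rewrite (leq_trans _ sp) // size_poly.
by move=> z /pb; rewrite /eval2 -horner_evalE -horner_map /= horner_evalE hornerC.
Qed.

(* Induction on the degree of a denominator of [g] in [x]: at a root [a] of the
   denominator, the numerator vanishes to order [x - a] at all points above [a]
   and is therefore divisible by [x - a]. *)
Lemma regular_poly (g : L) :
    (forall v a b, val_at d f beta v a b -> val_ge v 0 g) ->
  exists2 p : {poly {poly K}}, (size p <= d)%N & g = beta p.
Proof.
move=> g_reg; have [q [p [q0 sp e]]] := ff_frac ffL g.
have [m] := ubnP (size q); elim: m => // m IH in q p q0 sp e *.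
rewrite ltnS => ltqm.
have [sq|sq] := eqVneq (size q) 1%N.
  have [c c0 qE] : exists2 c, c != 0 & q = c%:P by apply/size_poly1P; rewrite sq.
  exists (c^-1%:P%:P * p).
    rewrite mul_polyC; apply: leq_trans sp; exact: size_scale_leq.
  by rewrite rmorphM -e mulrA -rmorphM -polyCM qE -polyCM mulVf // rmorph1 mul1r.
have [a ra] := closed_rootP _ sq.
have [q1 qE] := factor_theorem _ _ ra.
have q10 : q1 != 0 by apply: contraNneq q0 => q10; rewrite qE q10 mul0r.
have xa0 : beta ('X - a%:P)%:P != 0 by rewrite (ff_neq0 ffL) // polyXsubC_eq0.
have vp v b k : val_at d f beta v a b -> val_ge v k (beta ('X - a%:P)%:P) ->
    val_ge v k (beta p).
  move=> va vx; have [v_val _ _ _] := va.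
  rewrite -e qE polyCM rmorphM -[k]addr0; apply: (val_geM v_val).
    by rewrite -[k]add0r; apply: (val_geM v_val) vx; apply: val_at_ge0 va.
  exact: g_reg va.
have pa j : (p`_j).[a] = 0.
  have [ledj|ltjd] := leqP d j.
    by rewrite nth_default ?horner0 // (leq_trans sp).
  have [fa|fa] := eqVneq f.[a] 0.
    have ab : 0 ^+ d = f.[a] by rewrite fa expr0n gtn_eqF.
    have [v va] := val_at_exists d_gt1 size_f d_neq0 f_simple ffL ab.
    apply: (ramified_coef_eq0 va _ ltjd); apply: (vp _ _ _ va).
    by right; rewrite (val_at_ramified_x va).
  apply: unramified_coef_eq0 => // b ab.
  have [v va] := val_at_exists d_gt1 size_f d_neq0 f_simple ffL ab.
  have [v_val _ vx _] := va.
  have [/(ff_small_eq0 d_gt0 ffL sp) ->|p0] := eqVneq (beta p) 0.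
    by rewrite /eval2 !horner0.
  apply/eqP; rewrite -(val_at_gt0 ffL va p0).
  have /(val_geE p0) : val_ge v 1 (beta p) by apply: (vp _ _ _ va); right; rewrite -lezD1 add0r in vx.
  by rewrite -[in X in _ -> X]lezD1 add0r.
pose p1 : {poly {poly K}} := \poly_(j < size p) (p`_j %/ ('X - a%:P)).
have pE : p = ('X - a%:P)%:P * p1.
  apply/polyP => j; rewrite coefCM coef_poly; case: ltnP => [_|lesp].
    by rewrite mulrC divpK // dvdp_XsubCl; apply/eqP.
  by rewrite nth_default ?mulr0.
apply: (IH q1 p1) => //.
- by apply: leq_trans sp; apply: size_poly.
- by apply: (mulfI xa0); rewrite -rmorphM -pE -e qE polyCM rmorphM; ring.
- by move: ltqm; rewrite qE size_Mmonic ?monicXsubC // size_XsubC addn2.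
Qed.

End Regular.

(** * Torsion points *)

Lemma poly_single_root (K : closedFieldType) (a : K) (q : {poly K}) :
  (forall z, root q z -> z = a) -> q = lead_coef q *: ('X - a%:P) ^+ (size q).-1.
Proof.
move=> qa; have [r qE] := closed_field_poly_normal q.
have [->|q0] := eqVneq q 0; first by rewrite lead_coef0 scale0r.
have lq0 : lead_coef q != 0 by rewrite lead_coef_eq0.
have rE : r = nseq (size r) a.
  apply/all_pred1P/allP => z zr; apply/eqP/qa.
  by rewrite qE rootZ // root_prod_XsubC.
have sr : (size q).-1 = size r by rewrite qE size_scale // size_prod_XsubC.
by rewrite sr {1}qE {1}rE big_nseq iter_mulr_1.
Qed.

(** The monomial x y weighs d + n > d l because l < d, and y^2 weighs 2 n > d l because d > 2; only
    y and powers of x remain. *)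
Lemma low_weight (K : fieldType) (n d l : nat) (p : {poly {poly K}}) :
    (1 < l < d)%N -> n = (d.-1 * l)%N -> weight_le n d p (d * l)%N ->
  p = (p`_1`_0)%:P%:P * 'X + (p`_0)%:P.
Proof.
move=> /andP[l1 ld] nE pD; have p0 i j : (d * l < d * i + n * j)%N -> p`_j`_i = 0.
  move=> lt; apply/eqP; apply: contraT => /pD; rewrite lez_nat.
  by rewrite leqNgt lt.
have [d' dE] : exists d', d = d'.+1 by exists d.-1; lia.
rewrite dE /= in nE.
apply/polyP => -[|[|j]]; rewrite coefD coefCM coefX coefC /= ?mulr0 ?add0r ?mulr1 ?addr0 //.
  apply/polyP => -[|i]; rewrite coefC //=; apply: p0.
  by rewrite nE dE; nia.
by apply/polyP => i; rewrite coef0; apply: p0; rewrite nE dE; nia.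
Qed.

Section Torsion.

Variables (K : closedFieldType) (n d l : nat) (f : {poly K}).
Hypotheses (l_lt_d : (1 < l < d)%N) (nE : n = (d.-1 * l)%N).
Hypotheses (coprime_nd : coprime n d) (size_f : size f = n.+1).
Hypotheses (d_neq0 : d%:R != 0 :> K) (f_simple : no_repeated_roots f).
Variables (L : fieldType) (beta : {rmorphism {poly {poly K}} -> L}).
Hypothesis ffL : function_field d f beta.

Let d_gt2 : (2 < d)%N.
Proof. by case/andP: l_lt_d; apply: leq_ltn_trans. Qed.
Let d_gt1 : (1 < d)%N := ltnW d_gt2.
Let d_gt0 : (0 < d)%N := ltnW d_gt1.

Variables (vO vP : L -> int) (a b : K).
Hypotheses (vO_val : valuation beta vO) (vO_infty : vO (beta 'X%:P) < 0).
Hypothesis vP_at : val_at d f beta vP a b.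

Let vP_val : valuation beta vP. Proof. by case: vP_at. Qed.

(* The divisor of [g] is [k (P - O)]. *)
Record has_div (k : nat) (g : L) : Prop := HasDiv {
  div_neq0 : g != 0;
  div_P : vP g = k;
  div_O : vO g = - k%:Z;
  div_other : forall v, valuation beta v -> v <> vP -> v <> vO -> v g = 0 }.

Lemma val_infty_x : vO (beta 'X%:P) = - d%:Z.
Proof.
have sX : (size ('X%:P : {poly {poly K}}) <= d)%N.
  by rewrite (leq_trans (size_polyC_leq1 _)).
have X0 : ('X%:P : {poly {poly K}}) != 0 by rewrite polyC_eq0 polyX_eq0.
have [i [j [ij _ ->]]] := val_infty_top d_gt0 coprime_nd size_f ffL vO_val vO_infty sX X0.
move: ij; rewrite coefC; case: j => [|j] /=; last by rewrite coef0 eqxx.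
rewrite coefX; case: i => [|[|i]] //=; rewrite ?eqxx //.
by rewrite muln0 addn0 muln1.
Qed.

Lemma val_at_neq_infty v z w : val_at d f beta v z w -> v <> vO.
Proof. by move=> vz vE; have := val_at_x_ge0 ffL vz; rewrite vE vO_infty. Qed.

Lemma P_neq_O : vP <> vO.
Proof. exact: val_at_neq_infty vP_at. Qed.

Lemma has_divV k j g h : (j <= k)%N -> has_div k g -> has_div j h ->
  has_div (k - j) (g / h).
Proof.
move=> lejk [g0 gP gO g_] [h0 hP hO h_].
have h1 : h^-1 != 0 by rewrite invr_eq0.
split; first by rewrite mulf_neq0.
- by rewrite (valM vP_val) // (valV vP_val) // gP hP subzn.
- by rewrite (valM vO_val) // (valV vO_val) // gO hO -subzn //; ring.
- move=> v v_val vP' vO'.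
  by rewrite (valM v_val) // (valV v_val) // g_ // h_.
Qed.

Lemma has_div_zero k p z w : has_div k (beta p) -> w ^+ d = f.[z] ->
  eval2 z w p = 0 -> z = a /\ w = b.
Proof.
move=> [p0 _ _ pv] zw ev0.
have [v vz] := val_at_exists d_gt1 size_f d_neq0 f_simple ffL zw.
have v_pos : 0 < v (beta p) by rewrite (val_at_gt0 ffL vz) // ev0.
have vE : v = vP.
  apply: contrapT => vP'; move: v_pos; rewrite pv ?ltxx //; first by case: vz.
  exact: val_at_neq_infty vz.
have [_ _ vx vy] := vP_at; rewrite -vE in vx vy.
have xa0 : beta ('X - a%:P)%:P != 0 by rewrite (ff_neq0 ffL) // polyXsubC_eq0.
move: vx vy; rewrite !(val_at_gt0 ffL vz) ?(ff_yb_neq0 d_gt1 ffL) //.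
by rewrite /eval2 !hornerE !subr_eq0 => /eqP -> /eqP.
Qed.

Lemma has_div_at_P k p : (0 < k)%N -> has_div k (beta p) -> eval2 a b p = 0.
Proof.
move=> k0 [p0 pP _ _]; apply/eqP; rewrite -(val_at_gt0 ffL vP_at p0) pP.
by rewrite ltz_nat.
Qed.

(** Having no pole except at O, g is a polynomial in x and y, and its pole order k is the weight of
    its top monomial; the bound on k brings it into the range of [low_weight]. *)
Lemma has_div_poly k g : (k <= d * l)%N -> has_div k g ->
  exists (c : K) (w : {poly K}), let p := c%:P%:P * 'X + w%:P in
    [/\ g = beta p, weight_le n d p k
      & exists i j, p`_j`_i != 0 /\ k = (d * i + n * j)%N].
Proof.
move=> lek [g0 gP gO gv].
have [v z w vz|p sp gE] := regular_poly d_gt1 size_f d_neq0 f_simple ffL (g := g).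
  have [v_val _ _ _] := vz; right; have [->|vP'] := pselect (v = vP).
    by rewrite gP.
  by rewrite gv //; apply: val_at_neq_infty vz.
have p0 : p != 0 by apply: contraNneq g0 => p0; rewrite gE p0 rmorph0.
have [i [j [pij pD vp]]] := val_infty_top d_gt0 coprime_nd size_f ffL vO_val vO_infty sp p0.
have kE : k = (d * i + n * j)%N.
  by move: gO; rewrite gE vp => /oppr_inj [].
exists p`_1`_0, p`_0; rewrite /= -(low_weight l_lt_d nE); last first.
  by apply: weight_le_trans pD; rewrite lez_nat -kE.
by split=> //; [rewrite kE | exists i, j].
Qed.

(** Above each root z of w there is a point of the curve where w vanishes; only P is allowed, so z =
    a. Every valuation of w is then deg w times that of x - a, and deg w is nonzero because k >
    0. *)
Lemma has_div_x_poly k (w : {poly K}) : (0 < k)%N -> has_div k (beta w%:P) ->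
  has_div d (beta ('X - a%:P)%:P).
Proof.
move=> k0 wk; have [w0 wP wO wv] := wk.
have w0' : w != 0 by apply: contraNneq w0 => ->; rewrite !rmorph0.
have wE : w = lead_coef w *: ('X - a%:P) ^+ (size w).-1.
  apply: poly_single_root => z /rootP wz.
  have [y] : exists y, root ('X^d - f.[z]%:P) y.
    by apply/closed_rootP; rewrite size_XnsubC // eqSS -lt0n.
  rewrite /root !hornerE subr_eq0 => /eqP yz.
  by have [] := has_div_zero wk yz; rewrite ?eval2C.
have lw0 : lead_coef w != 0 by rewrite lead_coef_eq0.
have xa0 : beta ('X - a%:P)%:P != 0 by rewrite (ff_neq0 ffL) // polyXsubC_eq0.
have vw v : valuation beta v ->
    v (beta w%:P) = (size w).-1%:Z * v (beta ('X - a%:P)%:P).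
  move=> v_val; rewrite {1}wE -mul_polyC polyCM rmorphM polyC_exp rmorphXn.
  rewrite (valM v_val) ?expf_neq0 ?(ff_neq0 ffL) ?polyC_eq0 ?polyXsubC_eq0 //.
  by rewrite (valC v_val) (valX v_val) // add0r.
have vOx : vO (beta ('X - a%:P)%:P) = - d%:Z.
  rewrite (val_poly_infty d_gt0 coprime_nd size_f ffL vO_val vO_infty).
    by rewrite size_XsubC val_infty_x mul1r.
  by rewrite polyXsubC_eq0.
move: wO wP; rewrite !vw // vOx => kO kP.
have sw : (size w).-1%:Z != 0.
  by apply: contraTneq k0 => sw; move: kP; rewrite sw mul0r => -[<-].
split=> //.
- by apply: (mulfI sw); move: kO; rewrite kP; lia.
- move=> v v_val vP' vO'; apply: (mulfI sw).
  by rewrite -vw // wv // mulr0.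
Qed.

(* A polynomial in [x] alone with divisor [k (P - O)] is, up to a constant, a
   power of [x - a]. *)
Lemma has_div_y k g : (0 < k <= d * l)%N -> ~ has_div d (beta ('X - a%:P)%:P) ->
  has_div k g -> exists u : {poly K},
    [/\ has_div k (beta ('X - u%:P)), (n <= k)%N, (size u <= l.+1)%N
      & k = n \/ exists2 i, k = (d * i)%N & u`_i != 0].
Proof.
move=> /andP[k0 lek] not_x gk.
have [c [w [gE wle_k [i [j [pij kE]]]]]] := has_div_poly lek gk.
(* With c = 0 the function would be a polynomial in x alone, which the assumption on x - a
   excludes. *)
have c0 : c != 0.
  apply/eqP => c0; apply: not_x; rewrite gE c0 mul0r add0r in gk.
  exact: has_div_x_poly gk.
have pE1 : ((c%:P%:P * 'X + w%:P) : {poly {poly K}})`_1 = c%:P.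
  by rewrite coefD coefCM coefX coefC mulr1 addr0.
have pE0 : ((c%:P%:P * 'X + w%:P) : {poly {poly K}})`_0 = w.
  by rewrite coefD coefCM coefX coefC mulr0 add0r.
have lenk : (n <= k)%N.
  have := wle_k 0%N 1%N; rewrite pE1 coefC /= => /(_ c0).
  by rewrite muln0 muln1 add0n lez_nat.
have bc0 : beta c%:P%:P != 0 by rewrite (ff_neq0 ffL) // polyC_eq0.
pose u := - (c^-1 *: w).
have pE : c%:P%:P * 'X + w%:P = c%:P%:P * ('X - u%:P).
  have cu : c%:P * u = - w by rewrite mul_polyC /u scalerN scalerA divff // scale1r.
  by rewrite mulrBr -polyCM cu polyCN opprK.
exists u; split=> //.
- move: gk; rewrite gE pE rmorphM => -[g0 gP gO gv].
  have u0 : beta ('X - u%:P) != 0 by move: g0; rewrite mulf_eq0 negb_or => /andP[].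
  have vu v : valuation beta v -> v (beta c%:P%:P * beta ('X - u%:P)) = v (beta ('X - u%:P)).
    by move=> v_val; rewrite (valM v_val) // (valC v_val) add0r.
  by split=> //; [rewrite -vu | rewrite -vu | move=> v v_val ? ?; rewrite -vu // gv].
- rewrite size_polyN size_scale ?invr_eq0 //.
  apply/leq_sizeP => i' lti; apply/eqP; apply: contraT => wi.
  have := wle_k i' 0%N; rewrite pE0 => /(_ wi); rewrite lez_nat muln0 addn0 => led.
  have := leq_trans led lek; rewrite leq_pmul2l // leqNgt.
  by rewrite lti.
(* The top monomial is x^i, of weight d i, or y, of weight n. *)
case: j => [|[|j]] in pij kE *.
- right; exists i; first by rewrite kE muln0 addn0.
  by rewrite coefN coefZ oppr_eq0 mulf_neq0 ?invr_eq0 // -pE0.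
- left; rewrite kE; move: pij; rewrite pE1 coefC; case: i {kE} => [|i] /=.
    by rewrite muln0 muln1 add0n.
  by rewrite eqxx.
- by move: pij; rewrite coefD coefCM coefX coefC mulr0 addr0 coef0 eqxx.
Qed.

End Torsion.

Lemma mup_gt1 (F : fieldType) (f : {poly F}) (z : F) : f != 0 ->
  (1 < mup z f)%N = root f z && root f^`() z.
Proof.
move=> f0; rewrite mup_geq //; apply/idP/andP => [/dvdpP[h fE]|[fz f'z]].
  split; rewrite rootE fE.
    by rewrite hornerM horner_exp hornerXsubC subrr expr0n mulr0.
  rewrite derivM deriv_exp derivXsubC mul1r expr1 hornerD !hornerM hornerMn.
  by rewrite hornerXsubC subrr mul0rn !mulr0 addr0.
have [h fE] := factor_theorem _ _ fz.
move: f'z; rewrite fE derivM derivXsubC mulr1 rootE !hornerE subrr mulr0 add0r.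
by rewrite expr2 dvdp_mul2r ?polyXsubC_eq0 // dvdp_XsubCl.
Qed.

(** * The polynomials f for which y - u(x) vanishes only above a *)

Section TorsionPolynomial.

Variables (K : closedFieldType) (d l : nat) (lam a : K).
Hypotheses (d_gt1 : (1 < d)%N) (l_gt1 : (1 < l)%N) (lam_neq0 : lam != 0).
Hypothesis d_neq0 : d%:R != 0 :> K.

Local Notation B := (lam *: ('X - a%:P) ^+ l).

(** With u = B + mu, the equation of the curve reads y^d - u^d = - B^d, so y - u(x) can vanish only
    where x = a. *)
Definition torsion_poly (mu : K) : {poly K} := (B + mu%:P) ^+ d - B ^+ d.

Lemma size_torsion_B : size B = l.+1.
Proof. by rewrite size_scale // size_exp_XsubC. Qed.

Lemma lead_coef_torsion_B : lead_coef B = lam.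
Proof. by rewrite lead_coefZ lead_coef_exp lead_coefXsubC expr1n mulr1. Qed.

(** All d summands have degree (d - 1) l and leading coefficient lam^(d - 1); the total d lam^(d -
    1) is nonzero in K. *)
Lemma size_sum_pow (u w : {poly K}) : size u = l.+1 -> size w = l.+1 ->
    lead_coef u = lam -> lead_coef w = lam ->
  size (\sum_(i < d) u ^+ (d.-1 - i) * w ^+ i) = (d.-1 * l).+1.
Proof.
move=> su sw lu lw.
have u0 := size_poly_neq0 su; have w0 := size_poly_neq0 sw.
pose t (i : 'I_d) := u ^+ (d.-1 - i) * w ^+ i.
have tP i : size (t i) = (d.-1 * l).+1 /\ (t i)`_(d.-1 * l) = lam ^+ d.-1.
  have st : size (t i) = (d.-1 * l).+1.
    have t0 : t i != 0 by rewrite mulf_neq0 ?expf_neq0.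
    rewrite -(prednK (_ : 0 < size (t i))%N) ?size_poly_gt0 //.
    rewrite pred_size_mul ?expf_neq0 // !size_exp su sw /= -mulnDr subnK ?[(l * _)%N]mulnC //.
    by rewrite -ltnS prednK // (ltn_trans _ d_gt1).
  split=> //; have := lead_coefE (t i); rewrite st /= => <-.
  rewrite lead_coefM !lead_coef_exp lu lw -exprD subnK //.
  by rewrite -ltnS prednK // (ltn_trans _ d_gt1).
apply/eqP; rewrite eqn_leq; apply/andP; split.
  apply: (leq_trans (size_sum _ _ _)); apply/bigmax_leqP => i _.
  by have [-> _] := tP i.
rewrite ltnNge; apply/negP => /leq_sizeP/(_ _ (leqnn _)) /eqP.
rewrite coef_sum (eq_bigr (fun=> lam ^+ d.-1)) => [|i _]; last by have [_] := tP i.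
by rewrite sumr_const card_ord -mulr_natr mulf_eq0 (negPf d_neq0) expf_eq0 (negPf lam_neq0) andbF.
Qed.

(** In u^d - B^d = (u - B) S the sum S already has the full degree (d - 1) l, so u - B is a nonzero
    constant. *)
Lemma torsion_poly_unique (u : {poly K}) : size u = l.+1 -> lead_coef u = lam ->
    size (u ^+ d - B ^+ d) = (d.-1 * l).+1 ->
  exists2 mu, mu != 0 & u = B + mu%:P.
Proof.
move=> su lu; rewrite subrXX => sf.
have sS := size_sum_pow su size_torsion_B lu lead_coef_torsion_B.
have S0 := size_poly_neq0 sS.
have u0 : u - B != 0 by apply: contraTneq (size_poly_neq0 sf) => ->; rewrite mul0r eqxx.
move: sf; rewrite size_mul // sS addnS /=.
rewrite -[RHS]add1n => /addIn /eqP/size_poly1P[mu mu0 uE].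
by exists mu => //; rewrite -uE addrC subrK.
Qed.

Variables (mu : K) (mu_neq0 : mu != 0).

Lemma size_torsion_Bmu : size (B + mu%:P) = l.+1.
Proof.
rewrite size_polyDl size_torsion_B // (leq_ltn_trans (size_polyC_leq1 _)) //.
exact: ltnW.
Qed.

Lemma size_torsion_poly : size (torsion_poly mu) = (d.-1 * l).+1.
Proof.
rewrite /torsion_poly subrXX addrAC subrr add0r mul_polyC size_scale //.
apply: size_sum_pow => //; rewrite ?size_torsion_B ?size_torsion_Bmu //.
  rewrite lead_coefDl ?lead_coef_torsion_B // size_torsion_B.
  by rewrite (leq_ltn_trans (size_polyC_leq1 _)) // ltnW.
exact: lead_coef_torsion_B.
Qed.

(** The scalar l is isolated because it decides separability: if it is zero in K, the derivative
    vanishes identically and every root is multiple. *)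
Lemma deriv_torsion_poly : (torsion_poly mu)^`() =
  l%:R *: (d%:R *: (lam *: ('X - a%:P) ^+ l.-1 * ((B + mu%:P) ^+ d.-1 - B ^+ d.-1))).
Proof.
have dB : B^`() = l%:R *: (lam *: ('X - a%:P) ^+ l.-1).
  by rewrite derivZ deriv_exp derivXsubC mul1r -scaler_nat !scalerA mulrC.
rewrite /torsion_poly derivB !deriv_exp derivD derivC addr0 dB.
by rewrite -mulrnBl -mulrBr -scaler_nat -scalerAl !scalerA [d%:R * _]mulrC.
Qed.

(** At a multiple root either z = a, where the value is mu^d, or B and B + mu have equal powers of
    exponents d and d - 1. In the latter case mu B^(d - 1) = 0, so B = 0 and then mu = 0. *)
Lemma torsion_poly_simple : l%:R != 0 :> K -> no_repeated_roots (torsion_poly mu).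
Proof.
move=> l0 z; rewrite leqNgt mup_gt1 ?(size_poly_neq0 size_torsion_poly) //.
apply/negP => /andP[]; rewrite deriv_torsion_poly !rootZ // /root /torsion_poly.
rewrite !hornerE; set x := (z - a) ^+ l.
move=> /eqP/subr0_eq e1.
rewrite mulf_eq0 => /orP[|/eqP/subr0_eq e2].
  rewrite mulf_eq0 (negPf lam_neq0) expf_eq0 => /andP[_ za].
  move: e1; rewrite /x (eqP za) !expr0n !gtn_eqF // ?(ltnW l_gt1) ?(ltnW d_gt1) //.
  by rewrite mulr0 add0r expr0n gtn_eqF ?(ltnW d_gt1) // => /eqP; rewrite expf_eq0 (negPf mu_neq0) andbF.
move: e1; rewrite -(prednK (ltnW d_gt1)) !exprS e2 => /eqP.
rewrite -subr_eq0 -mulrBl addrAC subrr add0r mulf_eq0 (negPf mu_neq0) /= => B0.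
move: e2; rewrite (eqP B0) => /eqP; move: B0; rewrite !expf_eq0 => /andP[_ /eqP ->].
by rewrite add0r (negPf mu_neq0) andbF.
Qed.

Lemma torsion_poly_not_simple : l%:R = 0 :> K -> ~ no_repeated_roots (torsion_poly mu).
Proof.
move=> l0 simple; have f0 := size_poly_neq0 size_torsion_poly.
have [z fz] : exists z, root (torsion_poly mu) z.
  apply/closed_rootP; rewrite size_torsion_poly eqSS muln_eq0 negb_or.
  by case: (d) d_gt1 => [|[]] //= e _; case: (l) l_gt1.
have := simple z; rewrite leqNgt mup_gt1 // fz deriv_torsion_poly l0 scale0r.
by rewrite /root horner0 eqxx.
Qed.

End TorsionPolynomial.

(** * Functions with divisor k (P - O) *)

Section TorsionCurve.

Variables (K : closedFieldType) (n d l : nat).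
Hypotheses (l_lt_d : (1 < l < d)%N) (nE : n = (d.-1 * l)%N).
Hypotheses (coprime_nd : coprime n d) (d_neq0 : d%:R != 0 :> K).

Let l_gt1 : (1 < l)%N. Proof. by case/andP: l_lt_d. Qed.
Let d_gt2 : (2 < d)%N.
Proof. by case/andP: l_lt_d; apply: leq_ltn_trans. Qed.
Let d_gt1 : (1 < d)%N := ltnW d_gt2.
Let d_gt0 : (0 < d)%N := ltnW d_gt1.

Let n_lt_dl : (n < d * l)%N.
Proof. by rewrite nE ltn_pmul2r ?prednK // (ltn_trans _ l_gt1). Qed.

Let l_lt_n : (l < n)%N.
Proof. by rewrite nE ltn_Pmull // ?(ltn_trans _ l_gt1) // -subn1 ltn_subRL. Qed.

(* The function [y - u(x)] with divisor [d l (P - O)] gives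
   [f = u ^ d - (lam (x - a) ^ l) ^ d]; since [f] has degree [(d - 1) l] only,
   [u] differs from [lam (x - a) ^ l] by a constant. *)
Lemma torsion_curve_form (f : {poly K}) (L : fieldType)
    (beta : {rmorphism {poly {poly K}} -> L}) (vO vP : L -> int) (a b : K) g :
    size f = n.+1 -> no_repeated_roots f -> function_field d f beta ->
    valuation beta vO -> vO (beta 'X%:P) < 0 -> val_at d f beta vP a b ->
    has_div beta vO vP (d * l) g ->
    ~ has_div beta vO vP d (beta ('X - a%:P)%:P) ->
  exists lam, [/\ lam != 0, b != 0 & f = torsion_poly d l lam a b].
Proof.
move=> size_f f_simple ffL vO_val vO_infty vP_at gm not_x.
have dl0 : (0 < d * l)%N by apply: leq_ltn_trans n_lt_dl.
have [|u [um _ su [kn|[i /eqP ki ui]]]] := has_div_y l_lt_d nE coprime_nd size_f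
  d_neq0 f_simple ffL vO_val vO_infty vP_at _ not_x gm.
- by rewrite dl0 leqnn.
- by move: n_lt_dl; rewrite -kn ltnn.
(* As d l differs from n, the top monomial is a power of x, which gives u the exact degree l. *)
move: ki; rewrite eqn_pmul2l // => /eqP li; rewrite -li in ui.
have {}su : size u = l.+1.
  apply/eqP; rewrite eqn_leq su ltnNge; apply: contraNN ui => /leq_sizeP -> //.
have u0 := size_poly_neq0 su.
have lu0 : lead_coef u != 0 by rewrite lead_coef_eq0.
pose h := f - u ^+ d.
have sud : size (u ^+ d) = (d * l).+1.
  by rewrite -(prednK (_ : 0 < size (u ^+ d))%N) ?size_poly_gt0 ?expf_neq0 //
    size_exp su /= mulnC.
have sh : size h = (d * l).+1.
  by rewrite /h addrC size_polyDl ?size_polyN ?sud // size_f ltnS.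
have lh : lead_coef h = - lead_coef u ^+ d.
  rewrite /h addrC lead_coefDl ?size_polyN ?sud ?size_f ?ltnS //.
  by rewrite lead_coefN lead_coef_exp.
(* A root z of f - u^d gives the point (z, u(z)) of the curve, a zero of y - u(x), so z = a. The
   degree is d l because deg f = n < d l. *)
have hE : h = - lead_coef u ^+ d *: ('X - a%:P) ^+ (d * l).
  have := @poly_single_root _ a h; rewrite sh lh /=; apply => z.
  rewrite /root /h !hornerE subr_eq0 => /eqP hz.
  have [] := has_div_zero l_lt_d size_f d_neq0 f_simple ffL vO_infty vP_at um (esym hz) => //.
  by rewrite /eval2 !hornerE subrr.
pose B := lead_coef u *: ('X - a%:P) ^+ l.
have fE : f = u ^+ d - B ^+ d.
  by rewrite /B exprZn -exprM mulnC -scaleNr -hE /h addrC subrK.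
have sfB : size (u ^+ d - B ^+ d) = (d.-1 * l).+1 by rewrite -fE size_f nE.
have [mu mu0 uE] := torsion_poly_unique d_gt1 lu0 d_neq0 su erefl sfB.
have bE : b = mu.
  have := has_div_at_P ffL vP_at dl0 um; rewrite /eval2 !hornerE => /eqP.
  rewrite subr_eq0 {1}uE !hornerE subrr expr0n gtn_eqF ?(ltn_trans _ l_gt1) //.
  by rewrite mulr0 add0r => /eqP.
by exists (lead_coef u); rewrite bE; split=> //; rewrite {1}fE {1}uE.
Qed.

Variables (lam a b : K).
Hypotheses (lam_neq0 : lam != 0) (b_neq0 : b != 0) (l_neq0 : l%:R != 0 :> K).

Local Notation f := (torsion_poly d l lam a b).
Local Notation B := (lam *: ('X - a%:P) ^+ l).

Variables (L : fieldType) (beta : {rmorphism {poly {poly K}} -> L}).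
Hypothesis ffL : function_field d f beta.
Variables (vO vP : L -> int).
Hypotheses (vO_val : valuation beta vO) (vO_infty : vO (beta 'X%:P) < 0).
Hypothesis vP_at : val_at d f beta vP a b.

Let vP_val : valuation beta vP. Proof. by case: vP_at. Qed.

Let size_f : size f = n.+1.
Proof. by rewrite size_torsion_poly // nE. Qed.

Let f_simple : no_repeated_roots f.
Proof. exact: torsion_poly_simple. Qed.

Local Notation u := (B + b%:P).

Let vP_x : vP (beta ('X - a%:P)%:P) = 1.
Proof.
have := val_at_unif d_gt1 size_f d_neq0 f_simple ffL vP_at.
by rewrite (negPf b_neq0).
Qed.

(** At P, (y - u) S = f - u^d = - lam^d (x - a)^(d l), where S takes the value d b^(d - 1) and x - a
    has order 1. At O the top monomial is x^l, since n < d l. Any affine zero (z, w) has w = u(z),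
    hence B(z)^d = 0, z = a and w = b. *)
Lemma torsion_curve_div : has_div beta vO vP (d * l) (beta ('X - u%:P)).
Proof.
have g0 : beta ('X - u%:P) != 0.
  apply/eqP => /(ff_small_eq0 d_gt0 ffL); rewrite size_XsubC => /(_ d_gt1) /eqP.
  by rewrite polyXsubC_eq0.
have su : size u = l.+1 by apply: size_torsion_Bmu.
have eval_g z w : eval2 z w ('X - u%:P) = w - u.[z].
  by rewrite /eval2 hornerXsubC hornerD hornerN hornerC.
have ua : u.[a] = b.
  by rewrite !hornerE subrr expr0n gtn_eqF ?(ltn_trans _ l_gt1) // mulr0 add0r.
have xa0 : beta ('X - a%:P)%:P != 0 by rewrite (ff_neq0 ffL) // polyXsubC_eq0.
split=> //.
- pose S : {poly {poly K}} := \sum_(i < d) 'X^(d.-1 - i) * u%:P ^+ i.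
  have evS : eval2 a b S != 0.
    rewrite /eval2 !horner_sum (eq_bigr (fun=> b ^+ d.-1)) => [|i _].
      by rewrite sumr_const card_ord -mulr_natr mulf_neq0 ?expf_neq0.
    rewrite hornerM !horner_exp hornerX hornerC hornerM !horner_exp hornerC ua.
    by rewrite -exprD subnK // -ltnS prednK.
  have [_ _ vx vy] := vP_at.
  have vS := val_eq0_ff ffL vP_val vx vy evS.
  have S0 : beta S != 0 by apply: (eval2_neq0 ffL _ evS); case: vP_at.
  have <- : vP (beta ('X - u%:P) * beta S) = vP (beta ('X - u%:P)).
    by rewrite (valM vP_val) // vS addr0.
  rewrite -rmorphM -subrXX rmorphB rmorphXn (ff_eqn ffL) -polyC_exp -rmorphB -polyCB.
  have -> : f - u ^+ d = (- lam ^+ d) *: ('X - a%:P) ^+ (d * l).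
    by rewrite /torsion_poly addrAC subrr add0r exprZn -exprM mulnC scaleNr.
  rewrite -mul_polyC polyCM rmorphM (valM vP_val) ?(ff_neq0 ffL) //.
  + by rewrite (valC vP_val) polyC_exp rmorphXn (valX vP_val) // vP_x mulr1 add0r.
  + by rewrite polyC_eq0 oppr_eq0 expf_neq0.
  + by rewrite expf_neq0 // polyXsubC_eq0.
- have p0 : 'X - u%:P != 0 by rewrite polyXsubC_eq0.
  have sp : (size ('X - u%:P)%R <= d)%N by rewrite size_XsubC.
  have [i [j [pij pD ->]]] := val_infty_top d_gt0 coprime_nd size_f ffL vO_val vO_infty sp p0.
  congr (- _%:Z); apply/eqP; rewrite eqn_leq; apply/andP; split.
    case: j {pD} pij => [|[|j]]; rewrite coefB coefX coefC /=.
    + rewrite sub0r coefN oppr_eq0 => ui; rewrite muln0 addn0 leq_pmul2l //.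
      by rewrite -ltnS -su; apply: contraR ui; rewrite -leqNgt => /leq_sizeP ->.
    + rewrite subr0; case: i => [|i]; last by rewrite coef1 eqxx.
      by rewrite muln0 muln1 add0n (ltnW n_lt_dl).
    + by rewrite subrr coef0 eqxx.
  have := pD l 0%N; rewrite muln0 addn0 lez_nat; apply.
  rewrite coefB coefX coefC sub0r coefN oppr_eq0.
  by have := lead_coef_eq0 u; rewrite lead_coefE su (negPf (size_poly_neq0 su)) => ->.
- move=> v v_val vP' vO'.
  have [vx|[z [w vzw]]] := val_classify d_gt1 coprime_nd size_f d_neq0 ffL v_val.
    by case: vO'; apply: val_infty_eq d_gt0 coprime_nd size_f ffL v_val vO_val vx vO_infty.
  have [_ zw vx vy] := vzw.
  have [ev0|] := eqVneq (eval2 z w ('X - u%:P)) 0; last exact: (val_eq0_ff ffL v_val vx vy).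
  case: vP'; move: ev0; rewrite eval_g => /subr0_eq wE.
  have Bz : B.[z] ^+ d = 0.
    apply/eqP; move: zw; rewrite /torsion_poly hornerD hornerN !horner_exp -wE.
    by move=> /eqP; rewrite -subr_eq0 opprB addrCA subrr addr0.
  have za : z = a.
    move: Bz => /eqP; rewrite expf_eq0 hornerZ mulf_eq0 (negPf lam_neq0) horner_exp.
    by rewrite expf_eq0 hornerXsubC subr_eq0 => /andP[_ /andP[_ /eqP]].
  rewrite za in wE vzw; rewrite wE ua in vzw.
  exact: (val_at_eq d_gt1 size_f d_neq0 f_simple ffL vzw vP_at).
Qed.

(* A function with divisor [k (Q - O)] exists at most for [k = n]; dividing the
   one for [d l] by the one for [n] would give one for [d l - n = l <> n]. *)
Lemma torsion_curve_order k g : (0 < k < d * l)%N -> ~ has_div beta vO vP k g.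
Proof.
move=> k_bnd gk.
(* Since b is nonzero, x - a is a uniformizer at P and has order 1 < d there. *)
have not_x : ~ has_div beta vO vP d (beta ('X - a%:P)%:P).
  by case=> _; rewrite vP_x => -[d1]; move: d_gt1; rewrite -d1.
have yk j h : (0 < j < d * l)%N -> has_div beta vO vP j h -> j = n.
  move=> /andP[j0 ltj] hj.
  have [|w [_ lenj sw [//|[i ji wi]]]] := has_div_y l_lt_d nE coprime_nd size_f
    d_neq0 f_simple ffL vO_val vO_infty vP_at _ not_x hj.
    by rewrite j0 ltnW.
  (* Here j = d i with i < l, and n <= d i would give d (l - i) <= l < d, which is impossible. *)
  move: ltj lenj; rewrite ji ltn_pmul2l // nE => lti.
  have [d' dE] : exists d', d = d'.+1 by exists d.-1; rewrite prednK.
  by move: l_lt_d; rewrite dE /=; nia.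
have kn := yk k g k_bnd gk.
have /andP[_ /ltnW lek] := k_bnd.
have := has_divV vO_val vP_at lek torsion_curve_div gk.
have -> : (d * l - k = l)%N.
  by rewrite kn nE -[in X in (X - _)%N](prednK d_gt0) mulSn addnK.
have l_bnd : (0 < l < d * l)%N.
  by rewrite (ltn_trans _ l_gt1) // (ltn_trans l_lt_n).
by move=> /(yk _ _ l_bnd) ln; move: l_lt_n; rewrite -ln ltnn.
Qed.

End TorsionCurve.

(** Pairing b1 p / b1 q with b2 p / b2 q is a relation total on both sides and, as the kernels
    agree, one-to-one; choice extracts mutually inverse maps from it. Invertibility is a hypothesis
    on unit rings, so that the result applies to [funfield] with its own ring structure. *)
Lemma fraction_isom (B : comNzRingType) (L1 L2 : comUnitRingType)
    (b1 : {rmorphism B -> L1}) (b2 : {rmorphism B -> L2}) :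
    (forall g : L1, g != 0 -> g \is a GRing.unit) ->
    (forall g : L2, g != 0 -> g \is a GRing.unit) ->
    (forall g, exists q p, b1 q != 0 /\ b1 q * g = b1 p) ->
    (forall g, exists q p, b2 q != 0 /\ b2 q * g = b2 p) ->
    (forall p, b1 p = 0 <-> b2 p = 0) ->
  exists phi : {rmorphism L1 -> L2}, bijective phi /\ forall p, phi (b1 p) = b2 p.
Proof.
move=> unit1 unit2 frac1 frac2 ker.
have eq12 p q : b1 p = b1 q <-> b2 p = b2 q.
  split=> /eqP; rewrite -subr_eq0 -rmorphB => /eqP/ker/eqP.
    by rewrite rmorphB subr_eq0 => /eqP.
  by rewrite rmorphB subr_eq0 => /eqP.
have neq12 q : (b1 q != 0) = (b2 q != 0).
  by congr negb; apply/eqP/eqP => /ker.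
have b1M_neq0 q q' : b1 q != 0 -> b1 q' != 0 -> b1 (q * q') != 0.
  move=> q0 q'0; apply/eqP => e; have : b1 (q * q') \is a GRing.unit.
    by rewrite rmorphM unitrM !unit1.
  by rewrite e unitr0.
pose R g h := exists q p, [/\ b1 q != 0, b1 q * g = b1 p & b2 q * h = b2 p].
have R_total g : exists h, R g h.
  have [q [p [q0 e]]] := frac1 g; exists ((b2 q)^-1 * b2 p), q, p; split=> //.
  by rewrite mulVKr // unit2 // -neq12.
have R_surj h : exists g, R g h.
  have [q [p [q0 e]]] := frac2 h; exists ((b1 q)^-1 * b1 p), q, p.
  by split; rewrite ?neq12 // mulVKr // unit1 // neq12.
have R_fun g h g' h' : R g h -> R g' h' -> g = g' <-> h = h'.
  move=> [q [p [q0 e1 e2]]] [q' [p' [q'0 e1' e2']]].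
  have u1 : b1 (q * q') \is a GRing.unit by rewrite rmorphM unitrM !unit1.
  have u2 : b2 (q * q') \is a GRing.unit by rewrite rmorphM unitrM !unit2 // -neq12.
  have E1 : b1 (q * q') * g = b1 (p * q') by rewrite !rmorphM -e1; ring.
  have E1' : b1 (q * q') * g' = b1 (p' * q) by rewrite !rmorphM -e1'; ring.
  have E2 : b2 (q * q') * h = b2 (p * q') by rewrite !rmorphM -e2; ring.
  have E2' : b2 (q * q') * h' = b2 (p' * q) by rewrite !rmorphM -e2'; ring.
  split=> e.
    by apply: (mulrI u2); rewrite E2 E2'; apply/eq12; rewrite -E1 -E1' e.
  by apply: (mulrI u1); rewrite E1 E1'; apply/eq12; rewrite -E2 -E2' e.
have [phi phiP] := choice R_total.
have [psi psiP] := choice R_surj.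
have phiE g h : R g h -> phi g = h by move=> /(R_fun _ _ _ _ (phiP g)) [-> //].
have phib p : phi (b1 p) = b2 p.
  by apply: phiE; exists 1, p; rewrite !rmorph1 !mul1r oner_neq0.
have phiB : zmod_morphism phi.
  move=> g h; apply: phiE.
  have [q [p [q0 e1 e2]]] := phiP g; have [q' [p' [q'0 e1' e2']]] := phiP h.
  exists (q * q'), (p * q' - p' * q); split.
  - exact: b1M_neq0.
  - by rewrite rmorphB !rmorphM -e1 -e1'; ring.
  - by rewrite rmorphB !rmorphM -e2 -e2'; ring.
have phiM : monoid_morphism phi.
  split=> [|g h]; first by rewrite -(rmorph1 b1) phib rmorph1.
  apply: phiE.
  have [q [p [q0 e1 e2]]] := phiP g; have [q' [p' [q'0 e1' e2']]] := phiP h.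
  exists (q * q'), (p * p'); split.
  - exact: b1M_neq0.
  - by rewrite !rmorphM -e1 -e1'; ring.
  - by rewrite !rmorphM -e2 -e2'; ring.
pose phiA := GRing.isZmodMorphism.Build L1 L2 phi phiB.
pose phiR := GRing.isMonoidMorphism.Build L1 L2 phi phiM.
pose Phi : {rmorphism L1 -> L2} := HB.pack phi phiA phiR.
exists Phi; split=> //; exists psi => h.
  by apply/(R_fun _ _ _ _ (psiP (phi h)) (phiP h)).
exact: phiE (psiP h).
Qed.

(** * Affine changes of the coordinates x and y *)

Section Substitution.

Variable K : fieldType.

(* [p(s x + c, e y)] *)
Definition subst2 (s c e : K) : {poly {poly K}} -> {poly {poly K}} :=
  comp_poly (e%:P%:P * 'X) \o map_poly (comp_poly (s *: 'X + c%:P)).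

HB.instance Definition _ s c e := GRing.RMorphism.on (subst2 s c e).

Lemma subst2_y s c e : subst2 s c e 'X = e%:P%:P * 'X.
Proof. by rewrite /subst2 /= map_polyX comp_polyX. Qed.

Lemma subst2_poly s c e (q : {poly K}) :
  subst2 s c e q%:P = (q \Po (s *: 'X + c%:P))%:P.
Proof. by rewrite /subst2 /= map_polyC comp_polyC. Qed.

Lemma subst2_const s c e (k : K) : subst2 s c e k%:P%:P = k%:P%:P.
Proof. by rewrite subst2_poly comp_polyC. Qed.

Lemma eval2_subst2 s c e x y p :
  eval2 x y (subst2 s c e p) = eval2 (s * x + c) (e * y) p.
Proof.
elim/poly_ind: p => [|p q IH]; first by rewrite rmorph0 /eval2 !horner0.
rewrite rmorphD rmorphM /= !eval2D !eval2M IH subst2_y subst2_poly !eval2C.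
by rewrite eval2M eval2C horner_comp /eval2 !hornerE.
Qed.

Lemma subst2K s c e s' c' e' : s * s' = 1 -> s' * c + c' = 0 -> e' * e = 1 ->
  cancel (subst2 s' c' e') (subst2 s c e).
Proof.
move=> ss' cc' ee'; elim/poly_ind => [|p q IH]; first by rewrite !rmorph0.
rewrite !rmorphD !rmorphM /= IH !subst2_y !rmorphM /= subst2_const subst2_y.
have -> : e'%:P%:P * (e%:P%:P * 'X) = 'X :> {poly {poly K}}.
  by rewrite mulrA -!polyCM ee' mul1r.
congr (_ + _).
rewrite !subst2_poly -comp_polyA comp_polyD comp_polyZ comp_polyX comp_polyC.
by rewrite scalerDr scalerA -addrA scale_polyC -polyCD cc' addr0 [s' * s]mulrC ss' scale1r comp_polyXr.
Qed.

End Substitution.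

(** * The function field *)

Section Denominators.

Variable R : idomainType.

Lemma tofrac_inj : injective (@FracField.tofrac R).
Proof. by move=> p q /eqP; rewrite tofrac_eq => /eqP. Qed.

Lemma fraction_numden (c : {fraction R}) : exists n m : R,
  m != 0 /\ FracField.tofrac m * c = FracField.tofrac n.
Proof.
elim/quotW: c => x; exists (frac x).1, (frac x).2; split; first exact: denom_ratioP.
unlock FracField.tofrac; rewrite -[LHS]FracField.pi_mul; apply/eqmodP => /=.
rewrite FracField.equivfE /FracField.mulf !numden_Ratio ?oner_eq0 //.
  by rewrite mulr1 mul1r mulrC.
all: by rewrite mul1r denom_ratioP.
Qed.

Lemma poly_common_denom (s : {poly {fraction R}}) : exists (m : R) (p : {poly R}),
  m != 0 /\ (FracField.tofrac m)%:P * s = map_poly (@FracField.tofrac R) p.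
Proof.
elim/poly_ind: s => [|s c [m [p [m0 e]]]].
  by exists 1, 0; rewrite oner_neq0 mulr0 rmorph0.
have [n' [m' [m'0 e']]] := fraction_numden c.
exists (m * m'), (m'%:P * p * 'X + (m * n')%:P); rewrite mulf_neq0 //; split=> //.
rewrite rmorphD !rmorphM /= map_polyX !map_polyC /= -e.
rewrite mulrDr -!polyCM; congr (_ + _).
  by rewrite rmorphM; ring.
by rewrite -mulrA e' rmorphM.
Qed.

End Denominators.

Section FunctionField.

Variables (K : closedFieldType) (n d : nat) (f : {poly K}).
Hypotheses (d_gt0 : (0 < d)%N) (size_f : size f = n.+1).

Definition curve_map : {poly {poly K}} -> funfield d f :=
  in_qpoly (curve_eqn d f) \o map_poly (@FracField.tofrac {poly K}).

HB.instance Definition _ := GRing.RMorphism.on curve_map.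

(** The quotient is taken modulo [mk_monic], which keeps the given polynomial only if it is monic
    and not constant; d > 0 ensures this. *)
Lemma mk_monic_curve : mk_monic (curve_eqn d f) = curve_eqn d f.
Proof.
by rewrite /mk_monic /curve_eqn size_XnsubC // ltnS d_gt0 monicXnsubC.
Qed.

Lemma curve_map_poly (q : {poly K}) : curve_map q%:P = fratio d f (FracField.tofrac q).
Proof. by rewrite /curve_map /= map_polyC. Qed.

Lemma curve_map_const (c : K) : curve_map c%:P%:P = fconst d f c.
Proof. exact: curve_map_poly. Qed.

Lemma curve_map_x : curve_map 'X%:P = fx d f.
Proof. exact: curve_map_poly. Qed.

Lemma curve_map_y : curve_map 'X = fy d f.
Proof. by rewrite /curve_map /= map_polyX. Qed.

Lemma curve_map_xsub (a : K) :
  curve_map ('X - a%:P)%:P = fx d f - fconst d f a.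
Proof.
have -> : ('X - a%:P)%:P = 'X%:P - a%:P%:P :> {poly {poly K}} by rewrite polyCB.
rewrite -curve_map_x -curve_map_const.
exact: (rmorphB curve_map 'X%:P a%:P%:P).
Qed.

Lemma curve_map_ysub (b : K) :
  curve_map ('X - b%:P%:P) = fy d f - fconst d f b.
Proof.
rewrite -curve_map_y -curve_map_const.
exact: (rmorphB curve_map 'X b%:P%:P).
Qed.

Lemma size_funfield (g : funfield d f) : (size (g : {poly _}) <= d)%N.
Proof.
rewrite -ltnS; apply: leq_trans (size_mk_monic g) _.
by rewrite mk_monic_curve size_XnsubC.
Qed.

Lemma in_qpolyK (g : funfield d f) : in_qpoly (curve_eqn d f) g = g.
Proof. by apply: val_inj; apply: in_qpoly_small (size_mk_monic g). Qed.

(** For the kernel, the equation is monic in y, so division by it stays in K[x][y]; the remainder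
    has degree less than d and is therefore zero as soon as its image is. *)
Lemma curve_map_function_field : function_field d f curve_map.
Proof.
split.
- move=> g; have [m [p [m0 e]]] := poly_common_denom g.
  exists m, p; split=> //.
    rewrite -(size_map_inj_poly (@tofrac_inj {poly K}) _ p) ?rmorph0 // -e.
    by rewrite size_Cmul ?tofrac_eq0 // size_funfield.
  by rewrite /= curve_map_poly /fratio -[g in LHS]in_qpolyK -rmorphM e.
- move=> q q0; apply/unitrPr; exists (fratio d f (FracField.tofrac q)^-1).
  by rewrite /= curve_map_poly /fratio -rmorphM -polyCM mulfV ?tofrac_eq0 // rmorph1.
move=> p; have C_monic := curve_poly_monic f d_gt0.
have mapC : map_poly (@FracField.tofrac {poly K}) ('X^d - f%:P) = curve_eqn d f.
  by rewrite rmorphB /= map_polyXn map_polyC.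
have C0 : curve_map ('X^d - f%:P) = 0.
  apply: val_inj; rewrite /curve_map /= mapC mk_monic_curve.
  by rewrite Pdiv.RingMonic.rmodpp // /curve_eqn monicXnsubC.
split=> [p0|[u ->]]; last by rewrite rmorphM /= C0 mul0r.
have := Pdiv.RingMonic.rdivp_eq C_monic p.
set q := Pdiv.Ring.rdivp _ _; set r := Pdiv.Ring.rmodp _ _ => pE.
have sr : (size r <= d)%N.
  by rewrite -ltnS -(size_curve_poly f d_gt0) Pdiv.Ring.ltn_rmodpN0 // monic_neq0.
have r0 : curve_map r = 0.
  by have := congr1 curve_map pE; rewrite p0 rmorphD rmorphM /= C0 mulr0 add0r.
have : map_poly (@FracField.tofrac {poly K}) r = 0.
  have srh : (size (map_poly (@FracField.tofrac {poly K}) r) <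
      size (mk_monic (curve_eqn d f)))%N.
    rewrite mk_monic_curve size_XnsubC // ltnS.
    by rewrite (size_map_inj_poly (@tofrac_inj {poly K})) ?rmorph0.
  by rewrite -[LHS](in_qpoly_small srh); apply: (congr1 val r0).
rewrite -(rmorph0 (map_poly (@FracField.tofrac {poly K}))).
move=> /(map_inj_poly (@tofrac_inj {poly K}) (rmorph0 _)) r00.
by exists q; rewrite pE r00 addr0 mulrC.
Qed.

Hypothesis coprime_nd : coprime n d.

(** A nontrivial common factor D of g and the modulus h would give h = E D with D and E nonzero of
    smaller degree, hence zero divisors, against [ff_domain]. *)
Lemma funfield_unit (g : funfield d f) : g != 0 -> g \is a GRing.unit.
Proof.
move=> g0; have h_monic := monic_mk_monic (curve_eqn d f).
have h0 := monic_neq0 h_monic.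
have [/qpoly_mulzV gV|] := boolP (coprimep (mk_monic (curve_eqn d f)) g).
  by apply/unitrPr; exists (qpoly_inv g).
set h := mk_monic _ in h_monic h0 *; set D := gcdp h g => ncop.
have gp0 : (g : {poly _}) != 0 by apply: contraNneq g0 => g00; apply/eqP/val_inj.
have D0 : D != 0 by rewrite gcdp_eq0 negb_and h0.
have /dvdpP[E hE] : D %| h by apply: dvdp_gcdl.
have E0 : E != 0 by apply: contraNneq h0 => E0; rewrite hE E0 mul0r.
have sD : (1 < size D)%N.
  by move: ncop; rewrite /coprimep -/D; move: D0; rewrite -size_poly_gt0; case: (size D) => [|[]].
have sDh : (size D < size h)%N.
  by apply: leq_ltn_trans (size_mk_monic g); apply: dvdp_leq => //; apply: dvdp_gcdr.
have sEh : (size E < size h)%N.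
  rewrite hE size_mul // -[X in (X < _)%N]addn0 -subn1 -addnBA ?(ltnW sD) //.
  by rewrite ltn_add2l subn_gt0.
have small_neq0 (P : {poly {fraction {poly K}}}) : P != 0 -> (size P < size h)%N ->
    in_qpoly (curve_eqn d f) P != 0.
  move=> P0 sP; apply: contraNneq P0 => e; apply/eqP.
  by rewrite -[LHS](in_qpoly_small sP); apply: (congr1 val e).
have := ff_domain d_gt0 coprime_nd size_f curve_map_function_field
  (small_neq0 _ E0 sEh) (small_neq0 _ D0 sDh).
rewrite -rmorphM -hE => /eqP[]; apply: val_inj.
by rewrite /= Pdiv.RingMonic.rmodpp.
Qed.

End FunctionField.

Lemma point_inj (K : closedFieldType) (d : nat) (f : {poly K}) (P Q : point d f) :
  (P : funfield d f -> int) = Q -> P = Q.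
Proof.
case: P => p p1 p2 p3 p4 p5; case: Q => q q1 q2 q3 q4 q5 /= pq.
by case: _ / pq q1 q2 q3 q4 q5 => q1 q2 q3 q4 q5; congr Point; apply: Prop_irrelevance.
Qed.

(** * Points of the curve as valuations of its function field *)

Section CurvePoints.

Variables (K : closedFieldType) (n d : nat) (f : {poly K}).
Hypotheses (d_gt0 : (0 < d)%N) (coprime_nd : coprime n d) (size_f : size f = n.+1).

(** The carrier is that of [funfield], so that points are valuations of this field without any
    transport. *)
Definition funfield_field : fieldType :=
  HB.pack {poly %/ curve_eqn d f} (GRing.ComUnitRing_isField.Build {poly %/ curve_eqn d f}
    (fun g => funfield_unit d_gt0 size_f coprime_nd (g := g))).

Definition curve_mapF : {rmorphism {poly {poly K}} -> funfield_field} := curve_map d f.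

Lemma curve_mapF_function_field : function_field d f curve_mapF.
Proof. exact: curve_map_function_field d_gt0. Qed.

Lemma point_valuation (P : point d f) : valuation curve_mapF P.
Proof.
split; first exact: ord_zero.
- exact: ord_mul.
- exact: ord_add.
- by move=> c; rewrite -(ord_const P c) -curve_map_const.
- exact: ord_onto.
Qed.

Lemma valuation_point v : valuation curve_mapF v ->
  exists P : point d f, (P : funfield d f -> int) = v.
Proof.
case=> v0 vM vD vC vo.
have vC' (c : K) : v (fconst d f c) = 0 by rewrite -curve_map_const; apply: vC.
by exists (@Point _ d f v v0 vM vD vC' vo).
Qed.

Lemma at_infinityE (P : point d f) : at_infinity P <-> P (curve_mapF 'X%:P) < 0.
Proof. by rewrite /at_infinity -curve_map_x. Qed.

Lemma at_affineE (P : point d f) a b : at_affine P a b <-> val_at d f curve_mapF P a b.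
Proof.
rewrite /at_affine -curve_map_xsub -curve_map_ysub.
split=> [[ab vx vy]|[_ ab vx vy]]; last by split.
by split=> //; apply: point_valuation.
Qed.

Lemma principal_has_div (O P : point d f) k : P <> O ->
  principal (fun Q => abel_jacobi O P Q *+ k) <-> exists g, has_div curve_mapF O P k g.
Proof.
move=> PO; have OP : O <> P by move=> e; apply: PO.
split=> [[g g0 gD]|[g [g0 gP gO gv]]].
  have gE (Q : point d f) : Q g = abel_jacobi O P Q *+ k by rewrite -[LHS]/(div_fun g Q) -gD.
  exists g; split=> //.
  - by rewrite gE /abel_jacobi /div_point asboolT // asboolF // subr0 mulr1n natz.
  - by rewrite gE /abel_jacobi /div_point asboolF // asboolT // sub0r mulNrn mulr1n natz.
  - move=> v /valuation_point[Q <-] QP QO; rewrite gE /abel_jacobi /div_point.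
    rewrite asboolF; last by move=> QP'; apply: QP; rewrite QP'.
    rewrite asboolF; last by move=> QO'; apply: QO; rewrite QO'.
    by rewrite subrr mul0rn.
exists g => //; apply/funext => Q; rewrite /div_fun /abel_jacobi /div_point.
case: asboolP => [->|QP].
  by rewrite asboolF // subr0 mulr1n natz gP.
case: asboolP => [->|QO]; first by rewrite sub0r mulNrn mulr1n natz gO.
rewrite subrr mul0rn gv //; first exact: point_valuation.
  by move=> /point_inj.
by move=> /point_inj.
Qed.

Lemma principal_trivial (O : point d f) k :
  principal (fun Q => abel_jacobi O O Q *+ k).
Proof.
exists 1; first exact: oner_neq0.
apply/funext => Q; rewrite /abel_jacobi subrr mul0rn /div_fun.
by rewrite (val_one (point_valuation Q)).
Qed.

End CurvePoints.

Lemma valuation_comp (K L1 L2 : fieldType)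
    (b1 : {rmorphism {poly {poly K}} -> L1}) (b2 : {rmorphism {poly {poly K}} -> L2})
    (phi : {rmorphism L1 -> L2}) (v : L2 -> int) :
    bijective phi -> (forall c : K, phi (b1 c%:P%:P) = b2 c%:P%:P) ->
  valuation b2 v -> valuation b1 (v \o phi).
Proof.
move=> [psi _ psiK] phiC v_val; split.
- by rewrite /= rmorph0 (val_zero v_val).
- by move=> h k h0 k0; rewrite /= rmorphM (valM v_val) ?fmorph_eq0.
- move=> h k h0 k0 hk0; rewrite /= rmorphD; apply: (val_min v_val).
  + by rewrite fmorph_eq0.
  + by rewrite fmorph_eq0.
  + by rewrite -rmorphD fmorph_eq0.
- by move=> c; rewrite /= phiC (valC v_val).
- by have [t vt] := val_onto v_val; exists (psi t); rewrite /= psiK.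
Qed.

(** * Isomorphism onto the curve with lam = 1, a = 0, b = 1 *)

Section Isomorphism.

Variables (K : closedFieldType) (n d l : nat).
Hypotheses (l_lt_d : (1 < l < d)%N) (nE : n = (d.-1 * l)%N).
Hypotheses (coprime_nd : coprime n d) (d_neq0 : d%:R != 0 :> K).
Hypothesis l_neq0 : l%:R != 0 :> K.
Variables (lam a b : K).
Hypotheses (lam_neq0 : lam != 0) (b_neq0 : b != 0).

Let l_gt1 : (1 < l)%N. Proof. by case/andP: l_lt_d. Qed.
Let d_gt1 : (1 < d)%N. Proof. by case/andP: l_lt_d; apply: ltn_trans. Qed.
Let d_gt0 : (0 < d)%N := ltnW d_gt1.

Local Notation f := (torsion_poly d l lam a b).
Local Notation g := (torsion_poly d l 1 0 1 : {poly K}).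

Local Notation B := (lam *: ('X - a%:P) ^+ l).
Local Notation B1 := (1 *: ('X - 0%:P) ^+ l : {poly K}).

Let size_f : size f = n.+1.
Proof. by rewrite size_torsion_poly // nE. Qed.

Let size_g : size g = n.+1.
Proof. by rewrite size_torsion_poly ?oner_neq0 // nE. Qed.

Let g_simple : no_repeated_roots g.
Proof. by apply: torsion_poly_simple; rewrite ?oner_neq0. Qed.

(** The choice of s turns x^l into B / b, and so x^l + 1 into (B + b) / b; the factor b^(- d) is
    absorbed by y := y / b. *)
Lemma torsion_poly_comp (s : K) : s ^+ l = lam / b ->
  g \Po (s *: 'X + (- (s * a))%:P) = (b ^- d)%:P * f.
Proof.
move=> sl; have cX : ('X - 0%:P) ^+ l \Po (s *: 'X + (- (s * a))%:P)
    = (lam / b) *: ('X - a%:P) ^+ l.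
  rewrite subr0 comp_Xn_poly -sl -exprZn scalerBr; congr ((_ + _) ^+ l).
  by rewrite polyCN scale_polyC.
have cB : B1 \Po (s *: 'X + (- (s * a))%:P) = b^-1 *: B.
  by rewrite scale1r cX scalerA mulrC.
have cA : (B1 + 1%:P) \Po (s *: 'X + (- (s * a))%:P) = b^-1 *: (B + b%:P).
  by rewrite comp_polyD cB comp_polyC scalerDr scale_polyC mulVf.
rewrite /torsion_poly comp_polyB !(rmorphXn (comp_poly _)) /= cA cB.
by rewrite !exprZn -scalerBr mul_polyC exprVn.
Qed.

Lemma torsion_root_ex : exists2 s : K, s != 0 & s ^+ l = lam / b.
Proof.
have [s sl] : exists s : K, s ^+ l = lam / b.
  have [|s] := closed_rootP ('X^l - (lam / b)%:P) _.
    by rewrite size_XnsubC ?eqSS -?lt0n ltnW.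
  by rewrite /root !hornerE subr_eq0 => /eqP; exists s.
exists s => //; apply: contraTneq (mulf_neq0 lam_neq0 (invr_neq0 b_neq0)) => s0.
by rewrite -sl s0 expr0n gtn_eqF ?eqxx // ltnW.
Qed.

(** The substitution is an automorphism of K[x][y] that sends one curve equation to a unit multiple
    of the other, so [fraction_isom] applies to [b1] and to [b2] composed with it. *)
Lemma torsion_field_isom (s : K) (L1 L2 : comUnitRingType)
    (b1 : {rmorphism {poly {poly K}} -> L1}) (b2 : {rmorphism {poly {poly K}} -> L2}) :
    s != 0 -> s ^+ l = lam / b ->
    function_field d g b1 -> function_field d f b2 ->
    (forall h : L1, h != 0 -> h \is a GRing.unit) ->
    (forall h : L2, h != 0 -> h \is a GRing.unit) ->
  exists phi : {rmorphism L1 -> L2},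
    bijective phi /\ forall p, phi (b1 p) = b2 (subst2 s (- (s * a)) b^-1 p).
Proof.
move=> s0 sl ff1 ff2 unit1 unit2.
pose tau : {rmorphism {poly {poly K}} -> {poly {poly K}}} := subst2 s (- (s * a)) b^-1.
pose tau' : {rmorphism {poly {poly K}} -> {poly {poly K}}} := subst2 s^-1 a b.
have tauK : cancel tau tau'.
  by apply: subst2K; rewrite ?mulVf ?addrN //.
have tau'K : cancel tau' tau.
  apply: subst2K; rewrite ?mulfV //.
  by rewrite mulrN mulrA mulVf // mul1r addNr.
pose C (h : {poly K}) : {poly {poly K}} := 'X^d - h%:P.
have tauC : tau (C g) = (b ^- d)%:P%:P * C f.
  rewrite rmorphB rmorphXn /= subst2_y subst2_poly (torsion_poly_comp sl).
  by rewrite exprMn -!polyC_exp exprVn polyCM mulrBr.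
have tau'C : tau' (C f) = (b ^+ d)%:P%:P * C g.
  have -> : C f = (b ^+ d)%:P%:P * tau (C g).
    by rewrite tauC mulrA -!polyCM mulfV ?expf_neq0 // mul1r.
  by rewrite rmorphM tauK /= subst2_const.
pose b2' : {rmorphism {poly {poly K}} -> L2} := b2 \o tau.
apply: (fraction_isom (b1 := b1) (b2 := b2')) => //.
- move=> h; have [q [p [q0 _ e]]] := ff_frac ff1 h; exists q%:P, p; split=> //.
  by apply: contraTneq (ff_unit ff1 q0) => ->; rewrite unitr0.
- move=> h; have [q [p [q0 _ e]]] := ff_frac ff2 h; exists (tau' q%:P), (tau' p).
  rewrite /b2' /= !tau'K; split=> //.
  by apply: contraTneq (ff_unit ff2 q0) => ->; rewrite unitr0.
move=> p; split=> [/(ff_ker ff1)[u ->]|].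
  apply/(ff_ker ff2); exists ((b ^- d)%:P%:P * tau u).
  by rewrite rmorphM tauC mulrCA mulrA.
move=> /(ff_ker ff2)[u /(congr1 tau')]; rewrite tauK rmorphM tau'C => ->.
apply/(ff_ker ff1); exists ((b ^+ d)%:P%:P * tau' u).
by rewrite mulrCA mulrA.
Qed.

(** The pullback of P along phi is again a valuation; it has a pole at x, or is centred at (0, 1),
    and uniqueness at that place identifies it with Q. One phi serves for both pairs of points. *)
Lemma torsion_curve_isom : exists phi : {rmorphism funfield d g -> funfield d f},
  curve_isom phi /\ forall (P : point d f) (Q : point d g),
    (at_infinity P -> at_infinity Q -> isom_maps phi P Q) /\
    (at_affine P a b -> at_affine Q 0 1 -> isom_maps phi P Q).
Proof.
have [s s0 sl] := torsion_root_ex.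
have [phi [phi_bij phiE]] := @torsion_field_isom s (funfield d g) (funfield d f)
  (curve_map d g) (curve_map d f) s0 sl
  (curve_map_function_field g d_gt0) (curve_map_function_field f d_gt0)
  (fun h => @funfield_unit K n d g d_gt0 size_g coprime_nd h)
  (fun h => @funfield_unit K n d f d_gt0 size_f coprime_nd h).
exists phi; split.
  split=> // c; rewrite -!curve_map_const phiE.
  by rewrite subst2_const.
move=> P Q.
pose bg := curve_mapF d_gt0 coprime_nd size_g.
pose bf := curve_mapF d_gt0 coprime_nd size_f.
have ffg := curve_mapF_function_field d_gt0 coprime_nd size_g.
have fff := curve_mapF_function_field d_gt0 coprime_nd size_f.
have P_val := point_valuation d_gt0 coprime_nd size_f P.
have Q_val := point_valuation d_gt0 coprime_nd size_g Q.
have v_val : valuation bg (P \o phi).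
  apply: (@valuation_comp K (funfield_field d_gt0 coprime_nd size_g)
    (funfield_field d_gt0 coprime_nd size_f) bg bf phi P phi_bij _ P_val) => c.
  by rewrite [LHS]phiE subst2_const.
split=> [Pinf Qinf|Paff Qaff] h.
- have -> // : (Q : _ -> int) = P \o phi.
  apply: (val_infty_eq d_gt0 coprime_nd size_g
    ffg Q_val v_val).
    by apply/at_infinityE.
  rewrite /= phiE subst2_poly comp_polyX.
  have /(at_infinityE d_gt0 coprime_nd size_f) Px := Pinf.
  have sq : size (s *: 'X + (- (s * a))%:P) = 2%N.
    by rewrite size_polyDl size_scale ?size_polyX // ltnS size_polyC_leq1.
  have := val_poly_infty d_gt0 coprime_nd size_f
    fff P_val Px
    (size_poly_neq0 sq).
  by rewrite sq mul1r => ->.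
have -> // : (Q : _ -> int) = P \o phi.
have /(at_affineE d_gt0 coprime_nd size_g) Q_at := Qaff.
have /(at_affineE d_gt0 coprime_nd size_f) P_at := Paff.
apply: (val_at_eq d_gt1 size_g d_neq0 g_simple
  ffg Q_at).
have [_ g01 _ _] := Q_at.
have pos p : bg p != 0 -> eval2 0 1 p = 0 -> 0 < (P \o phi) (bg p).
  move=> p0 ev0; have bfE : phi (bg p) = bf (subst2 s (- (s * a)) b^-1 p) by exact: phiE.
  have bf0 : bf (subst2 s (- (s * a)) b^-1 p) != 0.
    rewrite -bfE; apply: contraNneq p0 => phi0.
    by apply/eqP; apply: (bij_inj phi_bij); rewrite phi0 rmorph0.
  rewrite /= bfE (val_at_gt0 fff P_at bf0) eval2_subst2.
  by rewrite addrN mulVf // ev0.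
split=> //; apply: pos.
- by rewrite (ff_neq0 ffg) // polyXsubC_eq0.
- by rewrite eval2C hornerXsubC subrr.
- exact: (ff_yb_neq0 d_gt1 ffg).
- by rewrite /eval2 hornerXsubC subrr horner0.
Qed.

End Isomorphism.

(** The hypothesis reads n + l = d l. Then l <= 1 would give n < d; the integer part satisfies l d
    <= n + d, whence l <= d; and l = d would make d divide n. *)
Lemma ell0_arith (n d : nat) : (2 <= d)%N -> (d < n)%N -> coprime n d ->
    n%:Z - (m0 n d)%:Z + (ell0 n d)%:Z = 0 ->
  (1 < ell0 n d < d)%N /\ n = (d.-1 * ell0 n d)%N.
Proof.
rewrite /m0; set l := ell0 n d => d2 dn cnd e.
have nE : (n + l = d * l)%N by apply/eqP; rewrite -eqz_nat PoszD; apply/eqP; lia.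
have [d' dE] : exists d', d = d'.+1 by exists d.-1; lia.
have nE' : n = (d.-1 * l)%N by rewrite dE /=; rewrite dE in nE; nia.
split=> //; apply/andP; split.
  by rewrite ltnNge; apply/negP => l1; rewrite dE /= in nE' dn; nia.
have led : (l * d <= n + d)%N by apply: leq_trunc_div.
rewrite ltn_neqAle; apply/andP; split; last by rewrite dE /= in nE' led *; nia.
apply/eqP => ld; move: cnd; rewrite nE' ld /coprime gcdnC gcdnMl.
by move/eqP => d1; rewrite d1 in d2.
Qed.

Lemma f0E (K : closedFieldType) (n d : nat) :
  f0 K n d = torsion_poly d (ell0 n d) 1 0 1.
Proof.
by rewrite /f0 /torsion_poly /m0 subr0 scale1r -exprM [(_ * d)%N]mulnC addrC.
Qed.

(** * Points of order d l on the curves *)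

Section Main.

Variables (K : closedFieldType) (K0 : divringClosed K) (n d l : nat).
Hypotheses (l_lt_d : (1 < l < d)%N) (nE : n = (d.-1 * l)%N).
Hypotheses (coprime_nd : coprime n d) (d_neq0 : d%:R != 0 :> K).

Let l_gt1 : (1 < l)%N. Proof. by case/andP: l_lt_d. Qed.
Let d_gt1 : (1 < d)%N. Proof. by case/andP: l_lt_d; apply: ltn_trans. Qed.
Let d_gt0 : (0 < d)%N := ltnW d_gt1.
Let dl_gt1 : (1 < d * l)%N.
Proof. by rewrite (ltn_trans d_gt1) // ltn_Pmulr. Qed.

(* [P] is an affine point, because [O] has order one. *)
Lemma order_curve_form (f : {poly K}) (O P : point d f) :
    size f = n.+1 -> no_repeated_roots f ->
    at_infinity O -> rational_point K0 P -> has_order O P (d * l) ->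
  exists lam a b, [/\ lam != 0, b != 0, at_affine P a b
    & f = torsion_poly d l lam a b].
Proof.
move=> size_f f_simple Oinf Prat [_ P_princ P_min].
have [PO|PO] := pselect (P = O).
  by case: (P_min 1%N); rewrite ?dl_gt1 // PO; exact: (principal_trivial d_gt0 coprime_nd size_f).
have ff := curve_mapF_function_field d_gt0 coprime_nd size_f.
have O_val := point_valuation d_gt0 coprime_nd size_f O.
have P_val := point_valuation d_gt0 coprime_nd size_f P.
have /(at_infinityE d_gt0 coprime_nd size_f) Ox := Oinf.
have [a [b P_at]] : exists a b, at_affine P a b.
  case: Prat => [Pinf|[a [b [_ _ P_at]]]]; last by exists a, b.
  case: PO; apply: point_inj.
  have /(at_infinityE d_gt0 coprime_nd size_f) Px := Pinf.
  exact: (val_infty_eq d_gt0 coprime_nd size_f ff P_val O_val Px Ox).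
have /(at_affineE d_gt0 coprime_nd size_f) Pv := P_at.
have /(principal_has_div d_gt0 coprime_nd size_f _ PO)[g gm] := P_princ.
(* As 0 < d < d l, such a divisor would contradict the minimality of the order of P. *)
have not_x : ~ has_div (curve_mapF d_gt0 coprime_nd size_f) O P d
    (curve_mapF d_gt0 coprime_nd size_f ('X - a%:P)%:P).
  move=> gd; apply: (P_min d); first by rewrite d_gt0 ltn_Pmulr.
  by apply/(principal_has_div d_gt0 coprime_nd size_f _ PO); eexists; apply: gd.
have [lam [lam0 b0 fE]] := torsion_curve_form l_lt_d nE coprime_nd d_neq0 size_f
  f_simple ff O_val Ox Pv gm not_x.
by exists lam, a, b.
Qed.

Hypothesis l_neq0 : l%:R != 0 :> K.

Local Notation g := (torsion_poly d l 1 0 1 : {poly K}).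

Let size_g : size g = n.+1.
Proof. by rewrite size_torsion_poly ?oner_neq0 // nE. Qed.

Lemma torsion_poly_over : degree_n_sqfree_over K0 n g.
Proof.
split=> //; last by apply: torsion_poly_simple; rewrite ?oner_neq0.
by rewrite /torsion_poly subr0 scale1r rpredB ?rpredX ?rpredD ?rpredX ?polyOverX ?rpred1.
Qed.

Lemma torsion_poly_order : exists O Q : point d g,
  [/\ at_infinity O, at_affine Q 0 1, rational_point K0 Q & has_order O Q (d * l)].
Proof.
have ff := curve_mapF_function_field d_gt0 coprime_nd size_g.
have [_ _ g_simple] := torsion_poly_over.
have [vO vO_val vOx] := val_infty_exists d_gt0 coprime_nd size_g ff.
have g01 : 1 ^+ d = g.[0].
  rewrite /torsion_poly subr0 !scale1r !hornerE !expr0n gtn_eqF ?(ltnW l_gt1) //.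
  by rewrite add0r expr1n expr0n gtn_eqF // subr0.
have [vQ vQ_at] := val_at_exists d_gt1 size_g d_neq0 g_simple ff g01.
have [O OE] := valuation_point vO_val.
have [vQ_val _ _ _] := vQ_at.
have [Q QE] := valuation_point vQ_val.
rewrite -OE in vO_val vOx; rewrite -QE in vQ_at vQ_val.
have Q_at : at_affine Q 0 1 by apply/(at_affineE d_gt0 coprime_nd size_g).
have QO : Q <> O.
  by move=> e; apply: (P_neq_O ff vOx vQ_at); rewrite e.
exists O, Q; split=> //.
- exact/(at_infinityE d_gt0 coprime_nd size_g).
- by right; exists 0, 1; rewrite rpred0 rpred1.
split; first exact: ltnW.
- apply/(principal_has_div d_gt0 coprime_nd size_g _ QO).
  eexists; apply: (torsion_curve_div l_lt_d nE coprime_nd d_neq0 (oner_neq0 _)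
    (oner_neq0 _) l_neq0 ff vO_val vOx vQ_at).
move=> k k_bnd /(principal_has_div d_gt0 coprime_nd size_g _ QO)[h hk].
exact: (torsion_curve_order l_lt_d nE coprime_nd d_neq0 (oner_neq0 _)
    (oner_neq0 _) l_neq0 ff vO_val vOx vQ_at k_bnd hk).
Qed.

End Main.

Theorem theorem3 (K : closedFieldType) (K0 : divringClosed K) (n d : nat)
    (hd : (2 <= d)%N) (hdn : (d < n)%N) (hnd : coprime n d)
    (hchar : char_ndvd K d) (hK0 : perfect_subfield K0)
    (hn : n%:Z - (m0 n d)%:Z + (ell0 n d)%:Z = 0) :
  [/\ reachable K0 n d (m0 n d) <-> char_ndvd K (ell0 n d),
      char_ndvd K (ell0 n d) ->
        degree_n_sqfree_over K0 n (f0 K n d) /\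
        exists O Q : point d (f0 K n d),
          [/\ at_infinity O, at_affine Q 0 1, rational_point K0 Q
            & has_order O Q (m0 n d)]
    & char_ndvd K (ell0 n d) ->
        forall f : {poly K}, degree_n_sqfree_over K0 n f ->
        forall O P : point d f,
          at_infinity O -> rational_point K0 P -> has_order O P (m0 n d) ->
        forall O0 Q0 : point d (f0 K n d),
          at_infinity O0 -> at_affine Q0 0 1 ->
        exists phi : {rmorphism funfield d (f0 K n d) -> funfield d f},
          [/\ curve_isom phi, isom_maps phi O O0 & isom_maps phi P Q0]].
Proof.
have [l_lt_d nE] := ell0_arith hd hdn hnd hn.
have d_neq0 : d%:R != 0 :> K by rewrite natf_neq0_pchar.
have charE : char_ndvd K (ell0 n d) -> (ell0 n d)%:R != 0 :> K.
  by rewrite natf_neq0_pchar.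
rewrite !f0E /m0; move: (ell0 n d) l_lt_d nE charE => l l_lt_d nE charE.
have l_gt1 : (1 < l)%N by case/andP: l_lt_d.
have part2 : char_ndvd K l -> degree_n_sqfree_over K0 n (torsion_poly d l 1 0 1) /\
    exists O Q : point d (torsion_poly d l 1 0 1 : {poly K}),
      [/\ at_infinity O, at_affine Q 0 1, rational_point K0 Q
        & has_order O Q (d * l)].
  move=> /charE l0; split; first exact: torsion_poly_over.
  exact: (torsion_poly_order K0 l_lt_d nE hnd d_neq0 l0).
split=> //.
- split=> [[_ [f [[_ size_f f_simple] [O [P [Oinf Prat Pord]]]]]]|cl].
    have [lam [a [b [lam0 b0 _ fE]]]] :=
      order_curve_form l_lt_d nE hnd d_neq0 size_f f_simple Oinf Prat Pord.
    rewrite /char_ndvd -natf_neq0_pchar; apply/eqP => l0.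
    by move: f_simple; rewrite fE; apply: torsion_poly_not_simple.
  have [gK0 [O [Q [Oinf _ Qrat Qord]]]] := part2 cl.
  split; first by rewrite (ltn_trans hd) // ltn_Pmulr // (ltnW hd).
  by exists (torsion_poly d l 1 0 1); split=> //; exists O, Q.
move=> /charE l0 f [_ size_f f_simple] O P Oinf Prat Pord O0 Q0 O0inf Q0aff.
have [lam [a [b [lam0 b0 Paff fE]]]] :=
  order_curve_form l_lt_d nE hnd d_neq0 size_f f_simple Oinf Prat Pord.
rewrite fE in O P Oinf Paff {Prat Pord} *.
have [phi [phi_isom phi_maps]] :=
  torsion_curve_isom l_lt_d nE hnd d_neq0 l0 a lam0 b0.
exists phi; split=> //.
- by have [H _] := phi_maps O O0; apply: H.
- by have [_ H] := phi_maps P Q0; apply: H.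
Qed.
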